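(* Let $r\ge 0$ be an integer, let $\Delta\subseteq\mathbb{R}^k$ be a $k$-dimensional simplicial complex, and let $\Delta'$ be a split subdivision of $\Delta$. Let $Q$ be the cokernel complex of the tautological chain map $v:\mathcal{R}/\mathcal{J}(\Delta)\to\mathcal{R}/\mathcal{J}(\Delta')$. If $H_{k-1}(\mathcal{R}/\mathcal{J}(\Delta))=0$, then $$0\longrightarrow S^r(\widehat\Delta)\longrightarrow S^r(\widehat\Delta')\longrightarrow H_k(Q)\longrightarrow 0$$ is an exact sequence, so for every $d$, $$\dim S^r(\widehat\Delta')_d=\dim S^r(\widehat\Delta)_d+\dim H_k(Q)_d.$$
   Context: $R=\mathbb{R}[x_0,\dots,x_k]$. For a $k$-dimensional (full-dimensional) simplicial complex $\Delta\subseteq\mathbb{R}^k$, $\Delta_i$ is the set of $i$-dimensional faces and $\Delta_i^0$ the set of interior $i$-dimensional faces (those not contained in the boundary $\partial(\Delta)$); all $k$-dimensional faces are considered interior, so $\Delta_k^0=\Delta_k$. $\Delta^0$ denotes the collection of interior faces. Fix a smoothness order $r\ge 0$. For a face $\tau\in\Delta_{k-1}$ let $l_{\hat\tau}\in R$ be the homogenization (with respect to $x_0$) of a linear form $l_\tau$ whose vanishing defines the affine span of $\tau$. For $\gamma\in\Delta_i^0$ with $i<k$, put $J(\Delta)_\gamma=\langle l_{\hat\tau}^{\,r+1}\mid \gamma\subseteq\tau\in\Delta_{k-1}\rangle\subseteq R$. The complex $\mathcal{R}/\mathcal{J}(\Delta)$ of graded $R$-modules is $$0\to\bigoplus_{\sigma\in\Delta_k}R\xrightarrow{\partial_k}\bigoplus_{\tau\in\Delta_{k-1}^0}R/J(\Delta)_\tau\xrightarrow{\partial_{k-1}}\cdots\xrightarrow{\partial_1}\bigoplus_{w\in\Delta_0^0}R/J(\Delta)_w\to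 0,$$ with $\partial_i$ induced by the usual simplicial boundary operator relative to the boundary of $\Delta$; the term indexed by $\Delta_i^0$ is in degree $i$. The same notation is used for $\Delta'$. $\widehat\Delta\subseteq\mathbb{R}^{k+1}$ is the cone over $\Delta$ (place $\Delta$ in the hyperplane $x_0=1$ and cone from the origin). $S^r(\widehat\Delta)$ is the graded $R$-module of splines of smoothness $r$ on $\widehat\Delta$ ($C^r$ functions that are polynomial on each maximal cell), identified with the top homology $H_k(\mathcal{R}/\mathcal{J}(\Delta))=\ker\partial_k$. A subscript $d$ denotes the degree-$d$ graded piece, and $\dim$ is dimension over $\mathbb{R}$. Simple subdivision: let $\sigma\in\Delta_k$ and let $\Delta''$ be a subdivision of $\sigma$ into a simplicial complex such that $\partial(\sigma)=\partial(\Delta'')$ on $\Delta^0$ (i.e. faces of $\sigma$ that are interior in $\Delta$ are not subdivided; the boundary of $\sigma$ may be modified only on $\sigma\cap\partial(\Delta)$). Replacing $\sigma$ by $\Delta''$ gives a simplicial complex $\Delta'$, called a simple subdivision of $\Delta$. Split subdivision: a simple subdivision $\Delta'$ such that for every $i$ and every $i$-face $\gamma$ of $\partial(\Delta'')$ that is not in $\partial(\Delta')$, one has $J(\Delta')_\gamma=J(\Delta)_\gamma$. Tautological chain map $v$: in degree $k$, $v_k$ sends the generator $1_\gamma$ of a cell $\gamma\in\Delta_k$ to $\sum_j 1_{\gamma'_j}$, the sum over the maximal cells $\gamma'_j$ of $\Delta'$ into which $\gamma$ is subdivided; in degrees $i<k$, $v_i$ is induced, i.e. on the summand of $\gamma\in\Delta_i^0$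 (which is also an interior face of $\Delta'$) it is the natural quotient map $R/J(\Delta)_\gamma\to R/J(\Delta')_\gamma$. $Q$ is the complex with $Q_i=\operatorname{coker}(v_i)$ and the induced differentials; the maps in the sequence of the claim are those induced on $H_k$ by $v$ and by the projection $\mathcal{R}/\mathcal{J}(\Delta')\to Q$. *)

(* Defs.v *)
(* MathComp, with the classical layer of MathComp-Analysis for [set] and for   *)
(* the type of reals.                                                          *)
From HB Require Import structures.
From mathcomp Require Import all_boot all_order all_algebra finmap.
From mathcomp Require Import boolp classical_sets reals mpoly.

Set Implicit Arguments.
Unset Strict Implicit.
Unset Printing Implicit Defensive.

Import Order.TTheory GRing.Theory Num.Theory.

Local Open Scope classical_set_scope.
Local Open Scope fset_scope.
Local Open Scope ring_scope.
Local Open Scope quotient_scope.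

(* -------------------------------------------------------------------------- *)
(* Generated submodules, quotient modules, cokernels                          *)
(* -------------------------------------------------------------------------- *)

Section Modules.
Variables (A : nzRingType) (V : lmodType A).

Definition gen (E : set V) : {pred V} :=
  fun x => `[< exists2 s : seq (A * V),
                 (forall p, p \in s -> E p.2) & x = \sum_(p <- s) p.1 *: p.2 >].

Lemma gen_closed (E : set V) : subsemimod_closed (gen E).
Proof.
split; first split.
- apply/asboolP; exists [::]; last by rewrite big_nil.
  by move=> p; rewrite in_nil.
- move=> x y /asboolP[s Es ->] /asboolP[t Et ->]; apply/asboolP.
  exists (s ++ t); last by rewrite big_cat.
  by move=> p; rewrite mem_cat => /orP[/Es|/Et].
- move=> a x /asboolP[s Es ->]; apply/asboolP.
  exists [seq (a * p.1, p.2) | p <- s].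
    by move=> p /mapP[q qs ->]; exact: (Es q qs).
  by rewrite big_map scaler_sumr; apply: eq_bigr => p _; rewrite scalerA.
Qed.

HB.instance Definition _ (E : set V) :=
  GRing.isSubmodClosed.Build A V (gen E) (gen_closed E).

(* The quotient of V by the submodule generated by E. *)
Definition modq (E : set V) := Quotient.quot (gen E).

Section Quot.
Variable E : set V.

HB.instance Definition _ := GRing.Zmodule.on (modq E).

Definition modq_pi (x : V) : modq E := \pi_(Quotient.quot (gen E)) x.
Definition modq_repr (x : modq E) : V := repr (x : Quotient.quot (gen E)).

Lemma modq_reprK : cancel modq_repr modq_pi. Proof. exact: reprK. Qed.

Lemma modq_piP (x y : V) : modq_pi x = modq_pi y <-> x - y \in gen E.
Proof.
rewrite /modq_pi; split => [xy|xy].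
  by rewrite Quotient.idealrBE; apply/eqP.
by apply/eqP; rewrite -Quotient.idealrBE.
Qed.

Lemma modq_piD (x y : V) : modq_pi (x + y) = modq_pi x + modq_pi y.
Proof. by rewrite /modq_pi !piE. Qed.

Definition modq_scale (a : A) (x : modq E) : modq E := modq_pi (a *: modq_repr x).

Lemma modq_scaleE a x : modq_scale a (modq_pi x) = modq_pi (a *: x).
Proof.
apply/modq_piP; rewrite -scalerBr rpredZ //.
by apply/modq_piP; rewrite modq_reprK.
Qed.

Fact modq_scaleA a b x : modq_scale a (modq_scale b x) = modq_scale (a * b) x.
Proof. by rewrite -(modq_reprK x) !modq_scaleE scalerA. Qed.

Fact modq_scale1 : left_id 1 modq_scale.
Proof. by move=> x; rewrite -(modq_reprK x) modq_scaleE scale1r. Qed.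

Fact modq_scaleDr : right_distributive modq_scale +%R.
Proof.
move=> a x y; rewrite -(modq_reprK x) -(modq_reprK y).
by rewrite -modq_piD !modq_scaleE scalerDr modq_piD.
Qed.

Fact modq_scaleDl x : {morph modq_scale^~ x : a b / a + b}.
Proof.
by move=> a b; rewrite -(modq_reprK x) !modq_scaleE scalerDl modq_piD.
Qed.

HB.instance Definition _ := GRing.Zmodule_isLmodule.Build A (modq E)
  modq_scaleA modq_scale1 modq_scaleDr modq_scaleDl.

Fact modq_pi_linear : linear modq_pi.
Proof. by move=> a x y; rewrite modq_piD -modq_scaleE. Qed.

HB.instance Definition _ :=
  GRing.isLinear.Build A V (modq E) _ modq_pi modq_pi_linear.

End Quot.
End Modules.

Section Induced.
Variables (A : nzRingType) (V W : lmodType A).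

(* The map V/<E> -> W/<E'> induced by f : V -> W; it is meaningful when f maps *)
(* E into <E'>, see inducedE.                                                 *)
Definition induced (E : set V) (E' : set W) (f : V -> W) : modq E -> modq E' :=
  fun x => modq_pi E' (f (modq_repr x)).

Arguments induced : clear implicits.

Lemma inducedE (E : set V) (E' : set W) (f : {linear V -> W}) :
  (forall x, E x -> f x \in gen E') ->
  forall x, induced E E' f (modq_pi E x) = modq_pi E' (f x) :> modq E'.
Proof.
move=> fE x; apply/modq_piP; rewrite -linearB.
have /asboolP[s Es ->] : modq_repr (modq_pi E x) - x \in gen E.
  by apply/modq_piP; rewrite modq_reprK.
rewrite linear_sum big_seq rpred_sum// => p /Es Ep.
by rewrite linearZZ rpredZ// fE.
Qed.

(* For linear f the range is already a submodule. *)
Definition coker (f : V -> W) := modq (range f).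

HB.instance Definition _ (f : V -> W) := GRing.Lmodule.on (coker f).

End Induced.

Arguments modq_pi {A V} E x.
Arguments induced {A V W} E E' f x.

Definition ker (V : Type) (W : nmodType) (f : V -> W) : set V :=
  [set x | f x = 0].

(* Exactness of 0 -> S1 -> S2 -> S3 -> 0, where S1, S2, S3 are submodules of   *)
(* U, V, W and the maps are the restrictions of f : U -> V and g : V -> W.     *)
Definition short_exact (A : nzRingType) (U V W : lmodType A)
    (S1 : set U) (S2 : set V) (S3 : set W) (f : U -> V) (g : V -> W) : Prop :=
  [/\ linear f /\ linear g,
      (f @` S1 `<=` S2)%classic,
      (forall x, S1 x -> f x = 0 -> x = 0),
      (f @` S1 = S2 `&` ker g)%classic
    & (g @` S2 = S3)%classic].

(* The R-subspace S of a module over R[x_0,...,x_n] has dimension m. *)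
Definition has_dim (R : realType) (n : nat) (V : lmodType {mpoly R[n]})
    (S : set V) (m : nat) : Prop :=
  exists e : 'I_m -> V,
    [/\ forall i, S (e i),
        forall x, S x -> exists c : 'I_m -> R, x = \sum_i (c i)%:MP *: e i
      & forall c : 'I_m -> R, \sum_i (c i)%:MP *: e i = 0 -> forall i, c i = 0].

(* -------------------------------------------------------------------------- *)
(* Simplicial complexes in R^k                                                *)
(* -------------------------------------------------------------------------- *)

Section Complexes.
Variables (R : realType) (k : nat).
Local Notation point := 'rV[R]_k.
Local Notation face := {fset point}.
Local Notation complex := {fset {fset point}}.
Local Notation poly := {mpoly R[k.+1]}.

Definition aff_span (s : face) : set point :=
  [set x | exists w : point -> R,
     \sum_(v <- s) w v = 1 /\ x = \sum_(v <- s) w v *: v].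

Definition hull (s : face) : set point :=
  [set x | exists w : point -> R,
     [/\ forall v, v \in s -> 0 <= w v,
         \sum_(v <- s) w v = 1 & x = \sum_(v <- s) w v *: v]].

Definition aff_indep (s : face) : Prop :=
  forall w : point -> R,
    \sum_(v <- s) w v = 0 -> \sum_(v <- s) w v *: v = 0 ->
    forall v, v \in s -> w v = 0.

(* A finite full-dimensional geometric simplicial complex; a simplex is given *)
(* by its vertex set and the empty set is not counted as a face.              *)
Record simplicial_complex (K : complex) : Prop := SimplicialComplex {
  sc_nonempty : fset0 \notin K;
  sc_indep : forall s, s \in K -> aff_indep s;
  sc_closed : forall s t : face, s \in K -> t `<=` s -> t != fset0 -> t \in K;
  sc_inter : forall s t, s \in K -> t \in K ->
    (hull s `&` hull t)%classic = hull (s `&` t);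
  sc_pure : forall s, s \in K -> exists t : face,
    [/\ t \in K, s `<=` t & #|` t| = k.+1] }.

Definition carrier (K : complex) : set point :=
  [set x | exists2 s, s \in K & hull s x].

(* Faces are graded by their number of vertices: faces K j consists of the     *)
(* (j-1)-dimensional faces.                                                   *)
Definition faces (K : complex) (j : nat) : complex :=
  [fset s in K | #|` s| == j].

(* The boundary complex: the faces of those (k-1)-dimensional faces that lie  *)
(* in exactly one k-dimensional face.                                         *)
Definition boundary (K : complex) : complex :=
  [fset s in K | has (fun t : face => (s `<=` t) &&
       (#|` [fset u in faces K k.+1 | t `<=` u]| == 1%N)) (faces K k)].

Definition interior_faces (K : complex) (j : nat) : complex :=
  faces K j `\` boundary K.

(* -------------------------------------------------------------------------- *)
(* Orientations                                                               *)
(* -------------------------------------------------------------------------- *)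

Definition vertex_le (u v : point) : bool :=
  ([seq u 0 i | i <- enum 'I_k] <= [seq v 0 i | i <- enum 'I_k] :> seqlexi R)%O.

Definition vertices (s : face) : seq point := sort vertex_le s.

(* The point (1, x), with coordinates x_0 = 1, x_1, ..., x_k. *)
Definition cone_point (x : point) : 'rV[R]_k.+1 := row_mx (1 : 'M_1) x.

(* Faces of dimension < k are oriented by the lexicographic order of their     *)
(* vertices, and k-dimensional faces by the orientation of R^k; orient s       *)
(* compares the chosen orientation with the lexicographic one. With this       *)
(* choice the maximal cells of a subdivision are coherently oriented, as       *)
(* needed for 1_s |-> sum_j 1_(s_j) to commute with the boundary operators.    *)
Definition orient (s : face) : R :=
  if #|` s| == k.+1
  then Num.sg (\det (\matrix_(i < k.+1) cone_point (nth 0 (vertices s) i)))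
  else 1.

(* The coefficient of t in the simplicial boundary of s. *)
Definition incidence (s t : face) : R :=
  \sum_(v <- s | s `\ v == t) (-1) ^+ index v (vertices s) * orient s.

(* -------------------------------------------------------------------------- *)
(* The complex R/J                                                            *)
(* -------------------------------------------------------------------------- *)

(* l is the homogenization of a linear form defining the affine span of t. *)
Definition span_form (t : face) (l : poly) : Prop :=
  l \is 1.-homog /\
  forall x : point, l.@[cone_point x 0] = 0 <-> aff_span t x.

(* The form of a (k-1)-face is unique up to a nonzero scalar, so taking all of *)
(* them as generators amounts to fixing one. No (k-1)-face contains a k-face,  *)
(* so J r K s = 0 when s is a k-face.                                         *)
Definition J (r : nat) (K : complex) (s : face) : {pred poly^o} :=
  gen (V := poly^o) [set p | exists t l, [/\ t \in faces K k, s `<=` t,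
    span_form t l & p = l ^+ r.+1]].

Section Chains.
Variables (r : nat) (K : complex) (j : nat).

Definition free_chain := {ffun interior_faces K j -> poly^o}.

HB.instance Definition _ := GRing.Lmodule.on free_chain.

Definition J_chain : set free_chain :=
  [set c | forall s : interior_faces K j, c s \in J r K (val s)].

(* The direct sum of the R/J_s over the interior (j-1)-dimensional faces s,    *)
(* that is, the term of R/J in homological degree j - 1.                      *)
Definition chain := modq J_chain.

HB.instance Definition _ := GRing.Lmodule.on chain.

End Chains.

Arguments J_chain : clear implicits.

(* The linear map between free chains with matrix m. *)
Definition free_map (K K' : complex) (i j : nat) (m : face -> face -> R)
    (c : free_chain K i) : free_chain K' j :=
  [ffun t => \sum_(s : interior_faces K i) (m (val s) (val t))%:MP * c s].

Fact free_map_linear K K' i j m : linear (@free_map K K' i j m).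
Proof.
move=> a c d; apply/ffunP => t; rewrite !ffunE scaler_sumr -big_split /=.
apply: eq_bigr => s _; rewrite !ffunE mulrDr; congr (_ + _).
by rewrite /GRing.scale /= mulrCA.
Qed.

HB.instance Definition _ K K' i j m := GRing.isLinear.Build poly
  (free_chain K i) (free_chain K' j) _ (@free_map K K' i j m)
  (@free_map_linear K K' i j m).

(* The boundary operator is compatible with the ideals J. *)
Lemma boundary_descends r K j (c : free_chain K j) :
  J_chain r K j c ->
  @free_map K K j j.-1 incidence c \in gen (J_chain r K j.-1).
Proof.
move=> Jc; set b := (X in X \in _); apply/asboolP.
exists [:: (1, b)]; last by rewrite big_seq1 scale1r.
move=> _ /[!inE]/eqP -> t /=; rewrite ffunE rpred_sum// => s _.
rewrite /incidence -big_filter; case E: [seq _ <- _ | _] => [|v vs].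
  by rewrite big_nil mpolyC0 mul0r rpred0.
have ts : val t `<=` val s.
  have : v \in [seq v <- val s | val s `\ v == val t] by rewrite E mem_head.
  by rewrite mem_filter => /andP[/eqP <- _]; exact: fsubD1set.
rewrite -[_ * _]/(_ *: (c s : poly^o)) rpredZ//.
have /asboolP[q qJ ->] := Jc s; apply/asboolP; exists q => // p /qJ.
by case=> u [l [uK su lu pl]]; exists u, l; split=> //; exact: fsubset_trans su.
Qed.

(* The differential from homological degree j - 1 to j - 2. The chains with    *)
(* j = 0 form the zero module.                                                *)
Definition diff (r : nat) (K : complex) (j : nat) :
    chain r K j -> chain r K j.-1 :=
  induced (J_chain r K j) (J_chain r K j.-1) (@free_map K K j j.-1 incidence).

(* Splines of smoothness r on the cone over K, under the identification of     *)
(* S^r with the top homology H_k(R/J) = ker d_k, the term of degree k + 1      *)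
(* being zero.                                                                *)
Definition splines (r : nat) (K : complex) : set (chain r K k.+1) :=
  ker (@diff r K k.+1).

(* H_(k-1)(R/J) = 0. *)
Definition next_homology_vanishes (r : nat) (K : complex) : Prop :=
  (ker (@diff r K k) `<=` range (@diff r K k.+1))%classic.

(* -------------------------------------------------------------------------- *)
(* Subdivisions                                                               *)
(* -------------------------------------------------------------------------- *)

(* K' is obtained from K by replacing the k-face s by its subdivision L.       *)
Record simple_subdivision (K : complex) (s : face) (L K' : complex) : Prop :=
  SimpleSubdivision {
  ss_cell : s \in faces K k.+1;
  ss_complex : simplicial_complex L;
  ss_carrier : carrier L = hull s;
  ss_boundary : forall g : face, (exists j, g \in interior_faces K j) ->
    (g `<` s <-> g \in boundary L);
  ss_faces : forall g : face, g \in K' <->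
    g \in L \/ (g != fset0 /\
                exists t, [/\ t \in faces K k.+1, t != s & g `<=` t]);
  ss_result : simplicial_complex K' }.

Definition split_subdivision (r : nat) (K K' : complex) : Prop :=
  exists s L, simple_subdivision K s L K' /\
    forall g, g \in boundary L -> g \notin boundary K' ->
      J r K' g =i J r K g.

(* -------------------------------------------------------------------------- *)
(* The tautological chain map and its cokernel                                *)
(* -------------------------------------------------------------------------- *)

(* The coefficient of t in the image of s: a k-face goes to the sum of the     *)
(* k-faces into which it is subdivided, a lower face goes to itself.          *)
Definition subdiv_coef (s t : face) : R :=
  (if #|` s| == k.+1 then `[< (hull t `<=` hull s)%classic >] else t == s)%:R.

(* taut and Q_diff below are induced maps: for a simple subdivision, J_s of    *)
(* K is contained in J_s of K', and the map on free chains commutes with the   *)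
(* boundary operators up to elements of J.                                    *)
Section Cokernel.
Variables (r : nat) (K K' : complex) (j : nat).

Definition taut : chain r K j -> chain r K' j :=
  induced (J_chain r K j) (J_chain r K' j) (@free_map K K' j j subdiv_coef).

Definition Q := coker taut.

HB.instance Definition _ := GRing.Lmodule.on Q.

Definition Q_pi : chain r K' j -> Q := modq_pi (range taut).

End Cokernel.

Definition Q_diff (r : nat) (K K' : complex) (j : nat) :
    Q r K K' j -> Q r K K' j.-1 :=
  induced (range (@taut r K K' j)) (range (@taut r K K' j.-1)) (@diff r K' j).

(* H_k(Q) = ker (Q_k -> Q_(k-1)). *)
Definition Q_top_homology (r : nat) (K K' : complex) : set (Q r K K' k.+1) :=
  ker (@Q_diff r K K' k.+1).

(* -------------------------------------------------------------------------- *)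
(* Gradings                                                                   *)
(* -------------------------------------------------------------------------- *)

Definition chain_homog (r : nat) (K : complex) (j d : nat) : set (chain r K j) :=
  [set x | exists2 c : free_chain K j,
     (forall s, (c s : poly) \is d.-homog) & x = modq_pi (J_chain r K j) c].

Definition Q_homog (r : nat) (K K' : complex) (j d : nat) : set (Q r K K' j) :=
  (@Q_pi r K K' j @` chain_homog d)%classic.

End Complexes.

Arguments splines {R k} r K.
Arguments taut {R k} r K K' j.
Arguments Q_pi {R k} r K K' j.
Arguments Q_top_homology {R k} r K K'.
Arguments chain_homog {R k} r K j d.
Arguments Q_homog {R k} r K K' j d.

(* Main.v *)
Require Import Defs.
From HB Require Import structures.
From mathcomp Require Import all_boot all_order all_algebra finmap.
From mathcomp Require Import boolp classical_sets reals mpoly.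

(** Let [v] be the tautological chain map, and call faces with [k.+1] vertices
    cells and faces with [k] vertices facets. If [v] were injective in all
    degrees, the claim would be a piece of the long exact homology sequence of
    [0 -> R/J(D) -> R/J(D') -> Q -> 0], since the connecting map takes [H_k(Q)]
    into [H_(k-1)(R/J(D)) = 0]. Only the three top degrees matter for this
    piece:

    - on cells all ideals [J] vanish, and [v] is injective because every cell of
      [D] contains a cell of [D'] that lies in no other cell of [D]
      ([own_cell], [taut_cells_inj]);
    - on facets [J] is generated by powers of the form of that single facet, so
      that it is the same for [D] and [D'] ([facet_J], [taut_facets_inj]);
    - one degree lower, where injectivity makes the values of the connecting
      map cycles, the equality of the ideals is the hypothesis that the
      subdivision is split ([split_J], [lifted_boundary_cycle]).

    The geometric content is that interior faces of [D] remain interior faces of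
    [D'] ([interior_face_subdivision]) and that [v] commutes with the top
    boundary operators ([refine_incidence]). Both come down to the relative
    position of cells around a facet. Two cells of a complex with a common facet
    lie on opposite sides of it ([opposite_vertices]): hence their incidence
    numbers with it cancel, and no facet is in three cells. A facet of the
    subdivision of [s] that is in a single cell lies in the boundary of [s]
    ([boundary_subdivision]): otherwise a point just beyond its barycenter would
    still be in [s] and would have to be covered by a second cell. The sides of
    a facet are told apart by the sign of a determinant ([side]), which is the
    sign that defines the incidence numbers of cells.

    For the dimensions, the ideals [J] are homogeneous, so taking the part of
    degree [d] commutes with the boundary operators and with [v], and the short
    exact sequence restricts to the parts of degree [d]. These are finite
    dimensional since monomials span them, and a basis of the middle term is
    obtained from bases of the outer terms ([has_dim_short_exact]). *)

Set Implicit Arguments.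
Unset Strict Implicit.
Unset Printing Implicit Defensive.

Import Order.TTheory GRing.Theory Num.Theory.

Local Open Scope classical_set_scope.
Local Open Scope ring_scope.

(** * Dimension of real subspaces *)

Section Dimension.
Variables (R : realType) (n : nat).
Local Notation A := {mpoly R[n]}.

Definition lincomb (V : lmodType A) (I : finType) (g : I -> V) (c : I -> R) : V :=
  \sum_i (c i)%:MP *: g i.

Definition real_subspace (V : lmodType A) (S : set V) : Prop :=
  forall (I : finType) (g : I -> V), (forall i, S (g i)) ->
    forall c : I -> R, S (lincomb g c).

Lemma real_subspaceP (V : lmodType A) (S : set V) :
  S 0 -> (forall x y, S x -> S y -> S (x + y)) ->
  (forall (c : R) x, S x -> S (c%:MP *: x)) -> real_subspace S.
Proof.
move=> S0 SD SZ I g Sg c; rewrite /lincomb.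
by elim/big_ind: _ => // i _; apply: SZ.
Qed.

Lemma lincomb_linear (V W : lmodType A) (f : V -> W) (I : finType)
    (g : I -> V) (c : I -> R) :
  linear f -> f (lincomb g c) = lincomb (f \o g) c.
Proof.
move=> lf; pose F : {linear V -> W} :=
  HB.pack f (GRing.isLinear.Build A V W *:%R f lf).
rewrite /lincomb -[f]/(F : V -> W) linear_sum.
by apply: eq_bigr => i _; rewrite linearZ.
Qed.

Definition real_free (V : lmodType A) (I : finType) (e : I -> V) : Prop :=
  forall c : I -> R, lincomb e c = 0 -> forall i, c i = 0.

(** With more vectors than generators, the coordinate matrix has a nonzero row
    vector in its kernel, which is a relation between the vectors. *)
Lemma real_free_bound (V : lmodType A) (I : finType) (g : I -> V) m
    (e : 'I_m -> V) :
  (forall i, exists c, e i = lincomb g c) -> real_free e -> (m <= #|I|)%N.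
Proof.
move=> /fin_all_exists[c ec] fe; rewrite leqNgt; apply/negP => Im.
pose M : 'M[R]_(m, #|I|) := \matrix_(i, j) c i (enum_val j).
have : kermx M != 0.
  rewrite -mxrank_eq0 mxrank_ker subn_eq0 -ltnNge.
  exact: leq_ltn_trans (rank_leq_col M) Im.
case/rowV0Pn => u /sub_kermxP uM u0.
case/negP: u0; apply/eqP/rowP => i; rewrite mxE.
apply: (fe (fun i => u 0 i)); rewrite /lincomb.
under eq_bigr => j _ do rewrite ec /lincomb scaler_sumr.
rewrite exchange_big big1// => j _.
under eq_bigr => l _ do rewrite scalerA -mpolyCM.
have /rowP/(_ (enum_rank j)) := uM; rewrite !mxE => uMj.
rewrite -scaler_suml.
suff -> : \sum_l (u 0 l * c l j)%:MP = 0 :> A by rewrite scale0r.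
rewrite -(raddf_sum (@mpolyC n R)) -[RHS](mpolyC0 n R); congr (_%:MP).
by apply: etrans uMj; apply: eq_bigr => l _; rewrite mxE enum_rankK.
Qed.

Lemma real_free_rcons (V : lmodType A) m (e : 'I_m -> V) x :
  real_free e -> ~ (exists c, x = lincomb e c) ->
  real_free (fun i : 'I_m.+1 => oapp e x (unlift ord_max i)).
Proof.
move=> fe nx c; rewrite /lincomb big_ord_recr /= unlift_none /=.
under eq_bigr => i _.
  rewrite (_ : widen_ord _ i = lift ord_max i); last first.
    by apply: val_inj; rewrite /= /bump leqNgt ltn_ord.
  rewrite liftK /=; over.
have [c0|c0] := eqVneq (c ord_max) 0; last first.
  move=> xe; case: nx; exists (fun i => - (c ord_max)^-1 * c (lift ord_max i)).
  rewrite /lincomb.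
  under eq_bigr => i _ do rewrite mpolyCM -scalerA.
  rewrite -scaler_sumr; move/eqP: xe; rewrite addr_eq0 => /eqP ->.
  by rewrite scalerN scalerA -mpolyCM mulNr mulVf// mpolyCN scaleN1r opprK.
rewrite c0 mpolyC0 scale0r addr0 => /fe ce i.
by have [j ->|->] := unliftP ord_max i; first exact: ce.
Qed.

(** A maximal free family in [S] is a basis, and the spanning family bounds
    the length of free families. *)
Lemma has_dim_exists (V : lmodType A) (S : set V) (I : finType) (g : I -> V) :
  (forall x, S x -> exists c, x = lincomb g c) -> exists m, has_dim S m.
Proof.
move=> Sg.
pose P m := `[< exists e : 'I_m -> V, (forall i, S (e i)) /\ real_free e >].
have P0 : exists m, P m.
  by exists 0%N; apply/asboolP; exists (fun=> 0); split => [|c _] [].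
have Pub m : P m -> (m <= #|I|)%N.
  by move=> /asboolP[e [Se fe]]; apply: (real_free_bound _ fe) => i; exact/Sg.
case: (ex_maxnP P0 Pub) => m /asboolP[e [Se fe]] mmax.
exists m, e; split=> // x Sx; apply: contrapT => nx.
suff /mmax : P m.+1 by rewrite ltnn.
apply/asboolP; exists (fun i => oapp e x (unlift ord_max i)); split.
  by move=> i; case: (unlift _ _) => //= j; exact: Se.
exact: real_free_rcons.
Qed.

(** A basis of the middle term: the images of a basis of [S1], followed by
    lifts of a basis of [S3]. *)
Lemma has_dim_short_exact (U V W : lmodType A) (f : U -> V) (g : V -> W)
    (S1 : set U) (S2 : set V) (S3 : set W) (a b : nat) :
  linear f -> linear g -> real_subspace S1 -> real_subspace S2 ->
  (forall x, S1 x -> S2 (f x)) -> (forall x, S2 x -> S3 (g x)) ->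
  (forall x, S1 x -> f x = 0 -> x = 0) ->
  (forall x, S1 x -> g (f x) = 0) ->
  (forall y, S2 y -> g y = 0 -> exists2 x, S1 x & f x = y) ->
  (forall z, S3 z -> exists2 y, S2 y & g y = z) ->
  has_dim S1 a -> has_dim S3 b -> has_dim S2 (a + b).
Proof.
move=> lf lg sub1 sub2 fS gS finj gf exact2 gsurj [e [Se spe fre]] [h [Sh sph frh]].
have [h' h'P] : exists h' : 'I_b -> V, forall i, S2 (h' i) /\ g (h' i) = h i.
  apply: (fin_all_exists (P := fun i y => S2 y /\ g y = h i)) => i.
  by have [y Sy gy] := gsurj _ (Sh i); exists y.
pose u i := match split i with inl i => f (e i) | inr j => h' j end.
have uE (c : 'I_(a + b) -> R) : lincomb u c =
    f (lincomb e (c \o lshift b)) + lincomb h' (c \o @rshift a b).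
  rewrite (lincomb_linear _ _ lf) /lincomb big_split_ord /=; congr (_ + _).
    by apply: eq_bigr => i _; rewrite /u (unsplitK (inl i)).
  by apply: eq_bigr => i _; rewrite /u (unsplitK (inr i)).
have gB y z : g (y - z) = g y - g z.
  by rewrite addrC -scaleN1r lg scaleN1r addrC.
have gD y z : g (y + z) = g y + g z.
  by rewrite addrC -[z]scale1r lg !scale1r addrC.
have fD y z : f (y + z) = f y + f z.
  by rewrite addrC -[z]scale1r lf !scale1r addrC.
have gh' c : g (lincomb h' c) = lincomb h c.
  rewrite (lincomb_linear _ _ lg); apply: eq_bigr => i _ /=.
  by rewrite (h'P i).2.
exists u; split.
- by move=> i; rewrite /u; case: split => j; [exact: fS|exact: (h'P j).1].
- move=> x Sx; have [ch gx] := sph _ (gS _ Sx).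
  have Sy : S2 (lincomb h' ch) by apply: sub2 => i; exact: (h'P i).1.
  have Sxy : S2 (x - lincomb h' ch).
    pose t (i : bool) := if i then x else lincomb h' ch.
    have := @sub2 _ t _ (fun i => if i then 1 else -1).
    rewrite /lincomb /t big_bool /= mpolyCN !scaleN1r scale1r; apply.
    by case.
  have [|y Sy' fy] := exact2 _ Sxy; first by rewrite gB gh' gx subrr.
  have [ce yE] := spe _ Sy'.
  exists (fun i => match split i with inl i => ce i | inr j => ch j end).
  apply/esym; etransitivity; first exact: uE.
  rewrite -[RHS](subrK (lincomb h' ch)) -fy; congr (_ + _).
    rewrite yE; congr f; apply: eq_bigr => i _ /=.
    by rewrite (unsplitK (inl i)).
  by apply: eq_bigr => i _ /=; rewrite (unsplitK (inr i)).
- move=> c; move: (uE c); rewrite {1}/lincomb => -> u0.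
  have ch0 i : c (rshift a i) = 0.
    apply: (frh (c \o @rshift a b)); rewrite -[LHS]gh'.
    have: g (f (lincomb e (c \o lshift b)) + lincomb h' (c \o @rshift a b)) = g 0.
      by rewrite u0.
    rewrite gD gf ?add0r; last exact: sub1.
    by move=> ->; rewrite -(subrr 0) gB subrr.
  have ce0 i : c (lshift b i) = 0.
    apply: (fre (c \o lshift b)); apply: finj; first exact: sub1.
    rewrite -[RHS]u0 [X in _ = _ + X]big1 ?addr0// => j _.
    by rewrite /= ch0 mpolyC0 scale0r.
  by move=> i; case: (splitP i) => j ij;
    [rewrite (_ : i = lshift b j)|rewrite (_ : i = rshift a j)] => //; exact: val_inj.
Qed.

End Dimension.

(** * Affine geometry of simplices *)

Section Affine.
Local Open Scope fset_scope.
Local Open Scope ring_scope.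
Variables (R : realType) (k : nat).
Local Notation point := 'rV[R]_k.
Local Notation face := {fset point}.
Implicit Types (s t : face) (u v x y : point) (w : point -> R).

Lemma sum_zero_ext (V : nmodType) s t (F : point -> V) : s `<=` t ->
  \sum_(v <- t) (if v \in s then F v else 0) = \sum_(v <- s) F v.
Proof.
move=> st; rewrite -(big_fset_incl _ st); last by move=> v _ /negPf ->.
by rewrite big_seq [RHS]big_seq; apply: eq_bigr => v ->.
Qed.

Lemma sum_zero_ext_scale s t w : s `<=` t ->
  \sum_(v <- t) (if v \in s then w v else 0) *: v = \sum_(v <- s) w v *: v.
Proof.
move=> st; rewrite -(sum_zero_ext _ st).
by apply: eq_bigr => v _; case: ifP => // _; rewrite scale0r.
Qed.

Lemma hull_sub s t : s `<=` t -> (hull s `<=` hull t)%classic.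
Proof.
move=> st x [w [w0 w1 wx]]; exists (fun v => if v \in s then w v else 0).
by split=> [v _||]; rewrite ?sum_zero_ext ?sum_zero_ext_scale//; case: ifP => // /w0.
Qed.

Lemma hull_vertex s v : v \in s -> hull s v.
Proof.
move=> vs; have : hull [fset v] v.
  by exists (fun=> 1); split; rewrite ?big_seq_fset1 ?scale1r.
by apply: hull_sub; apply/fsubsetP => u /[!inE]/eqP ->.
Qed.

Lemma hull0 x : ~ hull fset0 x.
Proof. by case=> w [_ /eqP]; rewrite big_seq_fset0 eq_sym oner_eq0. Qed.

Lemma aff_indep_uniq s w w' : aff_indep s ->
  \sum_(v <- s) w v = \sum_(v <- s) w' v ->
  \sum_(v <- s) w v *: v = \sum_(v <- s) w' v *: v ->
  forall v, v \in s -> w v = w' v.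
Proof.
move=> is_ e1 ex v vs; apply/eqP; rewrite -subr_eq0; apply/eqP.
apply: (is_ (fun v => w v - w' v)) => //; first by rewrite sumrB e1 subrr.
by under eq_bigr do rewrite scalerBl; rewrite sumrB ex subrr.
Qed.

(** Barycentric coordinates in [t] are unique, and those of a point of the
    face [s] vanish outside [s]. *)
Lemma aff_indep_hull s t x w : aff_indep t -> s `<=` t -> hull s x ->
  \sum_(v <- t) w v = 1 -> \sum_(v <- t) w v *: v = x ->
  forall v, v \in t -> v \notin s -> w v = 0.
Proof.
move=> it st [w' [_ w1 wx]] w1' wx' v vt vs.
have := @aff_indep_uniq t w (fun v => if v \in s then w' v else 0) it.
rewrite sum_zero_ext// sum_zero_ext_scale// w1 w1' wx' wx.
by move=> /(_ erefl erefl v vt) ->; rewrite (negPf vs).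
Qed.


Lemma vertex_le_total : total (@vertex_le R k).
Proof. by move=> u v; exact: le_total. Qed.

Lemma vertex_le_trans : transitive (@vertex_le R k).
Proof. by move=> v u x; exact: le_trans. Qed.

Lemma vertex_le_anti : antisymmetric (@vertex_le R k).
Proof.
move=> u v /le_anti /eq_in_map uv; apply/rowP => i; apply: uv.
exact: mem_enum.
Qed.

Lemma perm_vertices s : perm_eq (vertices s) s.
Proof. exact: permEl (perm_sort _ _). Qed.

Lemma mem_vertices s v : (v \in vertices s) = (v \in s).
Proof. exact: perm_mem (perm_vertices s) v. Qed.

Lemma uniq_vertices s : uniq (vertices s).
Proof. by rewrite (perm_uniq (perm_vertices s)) fset_uniq. Qed.

Lemma size_vertices s : size (vertices s) = #|` s|.
Proof. exact: perm_size (perm_vertices s). Qed.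

(** This is what reduces signs of iterated faces to positions in one list. *)
Lemma verticesD1 s v : vertices (s `\ v) = rem v (vertices s).
Proof.
have srt t : sorted (@vertex_le R k) (vertices t).
  exact: sort_sorted vertex_le_total _.
apply: (sorted_eq vertex_le_trans vertex_le_anti (srt _)).
  exact: (subseq_sorted vertex_le_trans (rem_subseq _ _) (srt s)).
apply: uniq_perm; rewrite ?rem_uniq ?uniq_vertices// => u.
by rewrite mem_vertices mem_rem_uniq ?uniq_vertices// !inE mem_vertices.
Qed.

Lemma sum_vertices (V : nmodType) s (F : point -> V) m : #|` s| = m ->
  \sum_(v <- s) F v = \sum_(i < m) F (nth 0 (vertices s) i).
Proof.
move=> <-; rewrite -(perm_big _ (perm_vertices s)) /= (big_nth 0) big_mkord.
by rewrite size_vertices.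
Qed.

(** The points of [R^k] sit in the hyperplane of first coordinate 1; the other
    values of [c] are taken by linear combinations of them. *)
Definition homog_vec (c : R) x : 'rV_k.+1 := row_mx (c%:M : 'M_1) x.

Lemma homog_vec_inj c c' x x' :
  homog_vec c x = homog_vec c' x' -> c = c' /\ x = x'.
Proof.
move=> /(@eq_row_mx _ 1 1 k _ _ _ _)[/matrixP/(_ 0 0)].
by rewrite !mxE !mulr1n.
Qed.

Lemma homog_vec0 : homog_vec 0 0 = 0.
Proof.
by apply/rowP => j; rewrite !mxE; case: (@splitP 1 k j) => l _; rewrite !mxE ?mul0rn.
Qed.

Lemma homog_vec1 x : homog_vec 1 x = cone_point x.
Proof. by []. Qed.

Lemma cone_point_sum (I : Type) (r : seq I) (a : I -> R) (f : I -> point) :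
  \sum_(i <- r) a i *: cone_point (f i) =
  homog_vec (\sum_(i <- r) a i) (\sum_(i <- r) a i *: f i).
Proof.
elim: r => [|i r IH]; first by rewrite !big_nil homog_vec0.
rewrite !big_cons IH; apply/rowP => j; rewrite !mxE.
case: (@splitP 1 k j) => l _; rewrite !mxE //.
by rewrite !ord1 !mulr1n mulr1.
Qed.

Definition vertex_matrix m s : 'M[R]_(m, k.+1) :=
  \matrix_(i < m) cone_point (nth 0 (vertices s) i).

Definition full_simplex s := aff_indep s /\ #|` s| = k.+1.

Lemma simplex_unitmx s : full_simplex s -> vertex_matrix k.+1 s \in unitmx.
Proof.
move=> [is_ ks]; rewrite -row_free_unit -kermx_eq0; apply/negPn/negP.
case/rowV0Pn => a /sub_kermxP aM; case/negP.
pose w v : R := a 0 (inord (index v (vertices s))).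
have wE (i : 'I_k.+1) : w (nth 0 (vertices s) i) = a 0 i.
  by rewrite /w index_uniq ?uniq_vertices ?size_vertices ?ks// inord_val.
have : \sum_i a 0 i *: cone_point (nth 0 (vertices s) i) = 0.
  apply: etrans aM; rewrite mulmx_sum_row; apply: eq_bigr => i _.
  by rewrite rowK.
rewrite cone_point_sum => /esym/(etrans homog_vec0)/homog_vec_inj[a1 ax].
apply/eqP/rowP => i; rewrite -wE mxE; apply: is_.
- by rewrite (sum_vertices _ ks); under eq_bigr do rewrite wE.
- by rewrite (sum_vertices _ ks); under eq_bigr do rewrite wE.
- by rewrite -mem_vertices mem_nth// size_vertices ks.
Qed.

(** Barycentric coordinates of [x] in the simplex [s]. Only the values at the
    vertices of [s] are determined. *)
Definition bary s x : point -> R :=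
  xget (fun=> 0) [set w | \sum_(v <- s) w v = 1 /\ \sum_(v <- s) w v *: v = x].

Lemma baryP s x : full_simplex s ->
  \sum_(v <- s) bary s x v = 1 /\ \sum_(v <- s) bary s x v *: v = x.
Proof.
move=> ss; have [is_ ks] := ss; rewrite /bary.
apply: (xgetPex _ (P := [set w : point -> R | \sum_(v <- s) w v = 1 /\
  \sum_(v <- s) w v *: v = x])).
pose a := (cone_point x : 'rV_k.+1) *m invmx (vertex_matrix k.+1 s).
have : \sum_i a 0 i *: cone_point (nth 0 (vertices s) i) = cone_point x.
  rewrite -[RHS](mulmxKV (simplex_unitmx ss)) mulmx_sum_row.
  by apply: eq_bigr => i _; rewrite rowK.
rewrite cone_point_sum -homog_vec1 => /homog_vec_inj[a1 ax].
exists (fun v => a 0 (inord (index v (vertices s)))).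
have wE (i : 'I_k.+1) :
    inord (index (nth 0 (vertices s) i) (vertices s)) = i.
  by rewrite index_uniq ?uniq_vertices ?size_vertices ?ks// inord_val.
by split; rewrite (sum_vertices _ ks); under eq_bigr do rewrite wE.
Qed.

Lemma bary_uniq s x w : full_simplex s ->
  \sum_(v <- s) w v = 1 -> \sum_(v <- s) w v *: v = x ->
  forall v, v \in s -> bary s x v = w v.
Proof.
move=> ss w1 wx; have [b1 bx] := baryP x ss.
by apply: aff_indep_uniq ss.1 _ _; rewrite ?w1 ?wx.
Qed.

(** The affine combination of the coordinates of the points [u] is a system of
    coordinates of their affine combination. *)
Lemma bary_affine s (t : seq point) w v : full_simplex s -> v \in s ->
  \sum_(u <- t) w u = 1 ->
  bary s (\sum_(u <- t) w u *: u) v = \sum_(u <- t) w u * bary s u v.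
Proof.
move=> ss vs w1.
apply: (bary_uniq (w := fun v => \sum_(u <- t) w u * bary s u v) ss) => //.
  rewrite exchange_big /= -[RHS]w1; apply: eq_bigr => u _.
  by rewrite -mulr_sumr (baryP u ss).1 mulr1.
under eq_bigr do rewrite scaler_suml.
rewrite exchange_big /=; apply: eq_bigr => u _.
under eq_bigr do rewrite -scalerA.
by rewrite -scaler_sumr (baryP u ss).2.
Qed.

Lemma bary_line s x y (e : R) v : full_simplex s -> v \in s ->
  bary s ((1 - e) *: x + e *: y) v = (1 - e) * bary s x v + e * bary s y v.
Proof.
move=> ss vs; have [[x1 xx] [y1 yy]] := (baryP x ss, baryP y ss).
apply: (bary_uniq (w := fun v => (1 - e) * bary s x v + e * bary s y v) ss) => //.
  by rewrite big_split /= -!mulr_sumr x1 y1 !mulr1 subrK.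
under eq_bigr do rewrite scalerDl -!scalerA.
by rewrite big_split /= -!scaler_sumr xx yy.
Qed.

Lemma bary_vertex s u v : full_simplex s -> u \in s -> v \in s ->
  bary s u v = (v == u)%:R.
Proof.
move=> ss us vs; have us' : [fset u] `<=` s by rewrite fsub1set.
apply: (bary_uniq (w := fun v => (v == u)%:R) ss) => //.
  transitivity (\sum_(v <- s) (if v \in [fset u] then 1 else 0 : R)).
    by apply: eq_bigr => v' _; rewrite inE; case: eqP.
  by rewrite sum_zero_ext// big_seq_fset1.
transitivity (\sum_(v <- s) (if v \in [fset u] then 1 else 0 : R) *: v).
  by apply: eq_bigr => v' _; rewrite inE; case: eqP.
by rewrite (sum_zero_ext_scale (fun=> 1))// big_seq_fset1 scale1r.
Qed.

Lemma simplex_hullP s x : full_simplex s ->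
  hull s x <-> forall v, v \in s -> 0 <= bary s x v.
Proof.
move=> ss; split => [[w [w0 w1 wx]] v vs|b0].
  by rewrite (bary_uniq ss w1 (esym wx))// w0.
by have [b1 bx] := baryP x ss; exists (bary s x).
Qed.

Lemma bary_face s t x v : full_simplex s -> t `<=` s -> hull t x ->
  v \in s -> v \notin t -> bary s x v = 0.
Proof.
move=> ss ts tx vs vt; have [b1 bx] := baryP x ss.
exact: (aff_indep_hull ss.1 ts tx b1 bx vs vt).
Qed.

Lemma hull_facet s x v : full_simplex s -> v \in s -> hull s x ->
  bary s x v = 0 -> hull (s `\ v) x.
Proof.
move=> ss vs /(simplex_hullP x ss) b0 bv; have [b1 bx] := baryP x ss.
exists (bary s x); split.
- by move=> u /fsetD1P[_ /b0].
- by rewrite -b1 [RHS](big_fsetD1 v)//= bv add0r.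
- by rewrite -[LHS]bx [LHS](big_fsetD1 v)//= bv scale0r add0r.
Qed.

(** The vertices of [s'] span the space affinely, so an affine function that
    vanishes on all of them is zero; the coordinate of [s] at [v] is not. *)
Lemma simplex_not_in_face_span s s' v : full_simplex s -> full_simplex s' -> v \in s ->
  exists2 u, u \in s' & bary s u v != 0.
Proof.
move=> ss ss' vs; apply: contrapT => nu.
have [w1 wv] := baryP v ss'.
have := bary_vertex ss vs vs; rewrite eqxx -{1}wv bary_affine//.
rewrite big_seq big1 => [/eqP|u us']; first by rewrite eq_sym oner_eq0.
have [->|u0] := eqVneq (bary s u v) 0; first by rewrite mulr0.
by case: nu; exists u.
Qed.

Definition barycenter t : point := \sum_(v <- t) (#|` t|%:R)^-1 *: v.

Lemma barycenter_weights t : t != fset0 -> \sum_(v <- t) (#|` t|%:R)^-1 = 1 :> R.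
Proof.
move=> t0; rewrite big_const_seq count_predT iter_addr_0 -[size _]/(#|` t|).
by rewrite -[LHS]mulr_natr mulVf// pnatr_eq0 -lt0n cardfs_gt0.
Qed.

Lemma card_inv_gt0 t : t != fset0 -> 0 < (#|` t|%:R)^-1 :> R.
Proof. by rewrite invr_gt0 ltr0n cardfs_gt0. Qed.

Lemma barycenter_hull t : t != fset0 -> hull t (barycenter t).
Proof.
move=> t0; exists (fun=> (#|` t|%:R)^-1); split => //.
  by move=> v _; rewrite ltW ?card_inv_gt0.
exact: barycenter_weights.
Qed.

Lemma bary_barycenter s t v : full_simplex s -> v \in s -> t != fset0 ->
  bary s (barycenter t) v = (#|` t|%:R)^-1 * \sum_(u <- t) bary s u v.
Proof.
move=> ss vs t0.
by rewrite bary_affine ?barycenter_weights// -mulr_sumr.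
Qed.

Lemma bary_barycenter_sub s t v : full_simplex s -> v \in s -> t `<=` s -> t != fset0 ->
  bary s (barycenter t) v = if v \in t then (#|` t|%:R)^-1 else 0.
Proof.
move=> ss vs ts t0.
apply: (bary_uniq (w := fun v => if v \in t then (#|` t|%:R)^-1 else 0)) => //.
  by rewrite sum_zero_ext// barycenter_weights.
by rewrite (sum_zero_ext_scale (fun=> (#|` t|%:R)^-1)).
Qed.

(** The barycenter of [t] is in no proper face, because its coordinates are
    all nonzero. *)
Lemma hull_barycenter s t : aff_indep t -> s `<=` t -> t != fset0 ->
  hull s (barycenter t) -> s = t.
Proof.
move=> it st t0 sb; apply/eqP; rewrite eqEfsubset st /=; apply/fsubsetP => v vt.
apply: contraT => vs; have := aff_indep_hull it st sb (barycenter_weights t0) erefl vt vs.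
by move/eqP; rewrite gt_eqF ?card_inv_gt0.
Qed.

(** A short move from a point towards another one keeps any finite number of
    affine functions positive where they were. *)
Lemma small_step (I : eqType) (r : seq I) (a b : I -> R) :
  exists2 e0, 0 < e0 < 1 & forall e, 0 < e <= e0 -> forall i, i \in r ->
    0 < a i -> 0 < (1 - e) * a i + e * b i.
Proof.
elim: r => [|i r [e0 /andP[e00 e01] IH]].
  by exists 2^-1 => //; rewrite invr_gt0 ltr0n invf_lt1 ?ltr1n.
have [ai|ai] := ltP 0 (a i); last first.
  exists e0; first by rewrite e00.
  move=> e ee j; rewrite inE => /predU1P[->|jr]; last exact: IH.
  by rewrite ltNge ai.
pose d := a i / (a i + `|b i - a i| + 1).
have den : 0 < a i + `|b i - a i| + 1.
  by rewrite ltr_wpDl// addr_ge0// ltW.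
have d0 : 0 < d by rewrite divr_gt0.
exists (Num.min e0 d).
  by rewrite lt_min e00 d0 /= gt_min e01.
move=> e /andP[e_gt0]; rewrite le_min => /andP[ee0 ed] j.
rewrite inE => /predU1P[->|jr]; last by apply: IH => //; rewrite e_gt0.
move=> _; rewrite mulrBl mul1r -addrA [- _ + _]addrC -mulrBr.
have [ba|ba] := leP 0 (b i - a i).
  by rewrite ltr_pwDl// mulr_ge0// ltW.
rewrite -[b i - a i]opprK -(ltr0_norm ba) mulrN subr_gt0.
apply: le_lt_trans (_ : d * `|b i - a i| < _); first by rewrite ler_wpM2r.
rewrite /d mulrAC ltr_pdivrMr// ltr_pM2l//.
by rewrite -addrA addrCA ltr_pwDr// ltr_wpDl// ltW.
Qed.

End Affine.

(** * Incidence numbers *)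

Section Incidence.
Local Open Scope fset_scope.
Local Open Scope ring_scope.
Variables (R : realType) (k : nat).
Local Notation point := 'rV[R]_k.
Local Notation face := {fset point}.
Implicit Types (s t : face) (u v w x : point).

Lemma nth_rem (T : eqType) (x0 v : T) (l : seq T) i : v \in l ->
  nth x0 (rem v l) i = nth x0 l (bump (index v l) i).
Proof.
move=> vl; rewrite remE nth_cat size_takel ?index_size// /bump.
by case: ltnP => iv; rewrite ?nth_take// nth_drop add1n addSn subnKC.
Qed.

Lemma index_rem_neq (T : eqType) (v w : T) (l : seq T) :
  v \in l -> w != v ->
  index w (rem v l) = (index w l - (index v l < index w l))%N.
Proof.
elim: l => //= a l IH; rewrite inE; have [-> _|av /= vl] := eqVneq v a.
  by move=> wa; rewrite ?[a == w]eq_sym (negPf wa) ltn0Sn subn1.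
move=> wv; have [wa|wa] := eqVneq a w.
  by [].
rewrite /= ?(negPf wa) IH// ltnS; case: ltnP => vw; last by rewrite !subn0.
by rewrite !subn1 prednK// (leq_ltn_trans _ vw).
Qed.

(** The determinant with first row [(1, x)] and next rows [(1, v)] for the
    vertices [v] of [t], expanded along its first row to show that it is
    affine in [x]. It vanishes on [t], and its sign tells on which side of [t]
    the point [x] lies. *)
Definition side t x : R := \sum_j cone_point x 0 j *
  ((-1) ^+ j * \det (col' j (vertex_matrix k t))).

Lemma side_comb t (r : seq point) (a : point -> R) : \sum_(u <- r) a u = 1 ->
  side t (\sum_(u <- r) a u *: u) = \sum_(u <- r) a u * side t u.
Proof.
move=> a1; rewrite /side -homog_vec1 -{1}a1 -(cone_point_sum r a id).
 under [RHS]eq_bigr do rewrite mulr_sumr.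
rewrite exchange_big; apply: eq_bigr => j _ /=.
rewrite summxE mulr_suml; apply: eq_bigr => u _.
by rewrite mxE mulrA.
Qed.

Lemma side_vertex t u : u \in t -> #|` t| = k -> side t u = 0.
Proof.
move=> ut kt.
pose B : 'M[R]_k.+1 := \matrix_(i < k.+1) cone_point (nth 0 (u :: vertices t) i).
have <- : \det B = side t u.
  rewrite (expand_det_row B ord0); apply: eq_bigr => j _.
  rewrite /cofactor add0n; congr (_ * _); first by rewrite !mxE.
  congr (_ * _); congr (\det _).
  by apply/matrixP => a b; rewrite !mxE.
have iu : (index u (vertices t) < k)%N.
  by rewrite -[X in (_ < X)%N]kt -size_vertices index_mem mem_vertices.
apply: (determinant_alternate (i1 := ord0) (i2 := lift ord0 (Ordinal iu))) => //.
by move=> j; rewrite !mxE /= nth_index ?mem_vertices.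
Qed.

(** Both sides are expanded along the row of [v]; the minors are the same, and
    the sign accounts for moving that row to the top. *)
Lemma det_vertex_matrix s v : v \in s -> #|` s| = k.+1 ->
  \det (vertex_matrix k.+1 s) =
  (-1) ^+ index v (vertices s) * side (s `\ v) v.
Proof.
move=> vs ks; have iv : (index v (vertices s) < k.+1)%N.
  by rewrite -[X in (_ < X)%N]ks -size_vertices index_mem mem_vertices.
rewrite (expand_det_row _ (Ordinal iv)) mulr_sumr; apply: eq_bigr => j _.
rewrite [X in X * _](_ : _ = cone_point v 0 j); last first.
  by rewrite mxE /= nth_index// mem_vertices.
rewrite /cofactor exprD /= -!mulrA [RHS]mulrCA.
do 3![congr (_ * _)]; congr (\det _).
apply/matrixP => a b; rewrite !mxE /= verticesD1 nth_rem// mem_vertices//.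
Qed.

Lemma incidence_facet_sum s v : v \in s ->
  incidence s (s `\ v) = (-1) ^+ index v (vertices s) * orient s.
Proof.
move=> vs; rewrite /incidence big_mkcond (big_fsetD1 v)//= eqxx big_seq big1 ?addr0//.
move=> u /fsetD1P[uv us]; case: eqP => // /fsetP/(_ u).
by rewrite !inE eqxx uv us.
Qed.

(** The sign of the position of [v] in the list of vertices appears both in
    the boundary operator and in the orientation of [s], and cancels. *)
Lemma incidence_facet s v : v \in s -> #|` s| = k.+1 ->
  incidence s (s `\ v) = Num.sg (side (s `\ v) v).
Proof.
move=> vs ks; rewrite incidence_facet_sum// /orient ks eqxx.
rewrite -[\matrix_(i < _) _]/(vertex_matrix k.+1 s) (det_vertex_matrix vs ks).
by rewrite sgrM sgrX sgrN1 mulrA -expr2 sqrr_sign mul1r.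
Qed.

Lemma incidence_notsub s t : ~~ (t `<=` s) -> incidence s t = 0.
Proof.
move=> ts; rewrite /incidence big1// => v /eqP st; case/negP: ts.
by rewrite -st; exact: fsubD1set.
Qed.

Lemma facet_vertex s t m : t `<=` s -> #|` s| = m.+1 -> #|` t| = m ->
  exists2 v, v \in s & t = s `\ v.
Proof.
move=> ts sm tm; have /cardfs1P[v sv] : #|` s `\` t| == 1%N.
  by rewrite cardfsDS// sm tm subSnn.
have /fsetDP[vs vt] : v \in s `\` t by rewrite sv inE.
exists v => //; apply/eqP; rewrite eqEfcard fsubsetD1 ts vt /=.
by move: (cardfsD1 v s); rewrite vs sm tm add1n => -[<-].
Qed.

(** Removing [v] and then [w] has the opposite sign of removing [w] and then
    [v]. Only the faces between [g] and [s] contribute, so the sum may run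
    over any family [T] containing them, such as the interior faces. Its
    members have orientation 1 because they are not cells. *)
Lemma boundary_boundary s g (T : {fset face}) :
  (forall v, v \in s -> g `<=` s `\ v -> s `\ v \in T) ->
  (forall t, t \in T -> orient t = 1) ->
  \sum_(t <- T) incidence s t * incidence t g = 0.
Proof.
move=> sT oT.
(* The contribution of removing v first and w second. *)
pose F v w : R := if (w != v) && (s `\ v `\ w == g) then
  (-1) ^+ index v (vertices s) * (-1) ^+ index w (vertices (s `\ v)) else 0.
have FC v w : v \in s -> w \in s -> F v w = - F w v.
  move=> vs ws; rewrite /F [v == w]eq_sym fsetDDl fsetUC -fsetDDl.
  case: ifP => [/andP[wv _]|]; last by rewrite oppr0.
  have vw : v != w by rewrite eq_sym.
  rewrite !verticesD1 !index_rem_neq ?mem_vertices//.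
  have : index w (vertices s) != index v (vertices s).
    by apply: contraNneq wv => /index_inj -> //; rewrite mem_vertices.
  have sgn (a b : nat) : (a < b)%N ->
      (-1) ^+ a * (-1) ^+ (b - 1) = - ((-1) ^+ b * (-1) ^+ a) :> R.
    by case: b => // b _; rewrite subSS subn0 exprS mulN1r mulNr opprK mulrC.
  case: ltngtP => // lt_vw _; rewrite subn0; first by rewrite sgn.
  by rewrite -[LHS]opprK -sgn// mulrC.
transitivity ((\sum_(v <- s) \sum_(w <- s) F v w) * orient s).
  transitivity (\sum_(v <- s) \sum_(t <- T) if s `\ v == t then
      (-1) ^+ index v (vertices s) * orient s * incidence t g else 0).
    rewrite exchange_big; apply: eq_bigr => t _.
    rewrite /incidence big_mkcond /= mulr_suml; apply: eq_bigr => v _.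
    by case: ifP; rewrite ?mul0r.
  rewrite mulr_suml big_seq [RHS]big_seq; apply: eq_bigr => v vs.
  have FE : orient (s `\ v) = 1 -> \sum_(w <- s) F v w =
      (-1) ^+ index v (vertices s) * incidence (s `\ v) g.
    move=> ov; rewrite /incidence [in RHS]big_mkcond /= [LHS](big_fsetD1 v)//=.
    rewrite {1}/F eqxx add0r mulr_sumr big_seq [RHS]big_seq.
    apply: eq_bigr => w /fsetD1P[wv _]; rewrite /F wv /=.
    by case: ifP; rewrite ?mulr0// ov mulr1.
  have [svT|svT] := boolP (s `\ v \in T).
    rewrite (big_fsetD1 (s `\ v))//= eqxx big_seq big1; last first.
      by move=> t /fsetD1P[/negPf tv _]; rewrite eq_sym tv.
    by rewrite addr0 (FE (oT _ svT)) mulrAC.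
  rewrite big_seq big1; last first.
    by move=> t tT; case: eqP => // st; rewrite st tT in svT.
  rewrite big1 ?mul0r// => w _; rewrite /F; case: ifP => // /andP[_ /eqP gE].
  by case/negP: svT; apply: sT => //; rewrite -gE; exact: fsubD1set.
set S := (X in X * _); suff -> : S = 0 by rewrite mul0r.
have : S = - S.
  rewrite {1}/S exchange_big /= -sumrN big_seq [RHS]big_seq.
  apply: eq_bigr => v vs; rewrite -sumrN big_seq [RHS]big_seq.
  by apply: eq_bigr => w ws; exact: FC.
by move/eqP; rewrite -addr_eq0 -mulr2n mulrn_eq0 => /eqP.
Qed.

End Incidence.

(** * Geometry of simplicial complexes *)

Section Complex.
Local Open Scope fset_scope.
Local Open Scope ring_scope.
Variables (R : realType) (k : nat).
Local Notation point := 'rV[R]_k.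
Local Notation face := {fset point}.
Variable K : {fset {fset point}}.
Hypothesis hK : simplicial_complex K.
Implicit Types (s t g c : face) (u v x : point).

Lemma in_facesP s j : s \in faces K j <-> s \in K /\ #|` s| = j.
Proof.
by rewrite !inE; split => [/andP[sK /eqP sj]|[-> ->]]; rewrite ?eqxx.
Qed.

Lemma face_neq0 s : s \in K -> s != fset0.
Proof. by move=> sK; apply: contraNneq (sc_nonempty hK) => <-. Qed.

Lemma cell_simplex c : c \in faces K k.+1 -> full_simplex c.
Proof. by move=> /in_facesP[cK kc]; split=> //; exact: sc_indep cK. Qed.

Lemma face_cell s : s \in K -> exists2 c, c \in faces K k.+1 & s `<=` c.
Proof.
by move=> /(sc_pure hK)[c [cK sc kc]]; exists c => //; apply/in_facesP.
Qed.

Lemma carrier_cell x : carrier K x -> exists2 c, c \in faces K k.+1 & hull c x.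
Proof.
by move=> [s /face_cell[c cK sc] sx]; exists c => //; exact: hull_sub sx.
Qed.

(** A vertex is a face, so it meets the simplex [t] in the hull of a common
    face. *)
Lemma complex_vertex g t v : g \in K -> t \in K -> v \in g -> hull t v -> v \in t.
Proof.
move=> gK tK vg tv; have vgs : [fset v] `<=` g by rewrite fsub1set.
have v0 : [fset v] != fset0.
  by apply/eqP => /fsetP/(_ v); rewrite !inE eqxx.
have : (hull [fset v] `&` hull t)%classic v.
  by split => //; apply: hull_vertex; rewrite inE.
have vK := sc_closed hK gK vgs v0.
rewrite (sc_inter hK vK tK) => hv.
have /fset0Pn[u] : [fset v] `&` t != fset0.
  by apply/eqP => e; rewrite e in hv; exact: hull0 hv.
by rewrite !inE => /andP[/eqP ->].
Qed.

Lemma complex_sub g t : g \in K -> t \in K ->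
  (forall v, v \in g -> hull t v) -> g `<=` t.
Proof.
by move=> gK tK gt; apply/fsubsetP => v vg; apply: (complex_vertex gK) => //; exact: gt.
Qed.

Lemma face_eq s t : s `<=` t -> #|` t| = #|` s| -> s = t.
Proof. by move=> st e; apply/eqP; rewrite eqEfcard st e leqnn. Qed.

Lemma boundaryP s : s \in boundary K <-> s \in K /\
  exists t c, [/\ t \in faces K k, s `<=` t, c \in faces K k.+1, t `<=` c &
    forall c', c' \in faces K k.+1 -> t `<=` c' -> c' = c].
Proof.
rewrite /boundary inE; split.
  move=> /andP[sK /hasP[t tK /andP[st /cardfs1P[c cE]]]]; split => //.
  exists t, c; have : c \in [fset c] by rewrite inE.
  rewrite -cE inE => /andP[cK tc]; split => // c' c'K tc'.
  by apply/eqP; rewrite -in_fset1 -cE inE; apply/andP.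
move=> [sK [t [c [tK st cK tc uniq_c]]]]; apply/andP; split => //.
apply/hasP; exists t => //; rewrite st /=; apply/cardfs1P; exists c.
apply/fsetP => c'; rewrite in_fset1 inE; apply/andP/eqP => [[]|->]; last by [].
exact: uniq_c.
Qed.

Lemma boundary_face s t : s \in K -> s `<=` t -> t \in boundary K ->
  s \in boundary K.
Proof.
move=> sK st /boundaryP[tK [f [c [fK tf cK fc uc]]]]; apply/boundaryP; split=> //.
by exists f, c; split=> //; exact: fsubset_trans tf.
Qed.

Lemma boundary_card s : s \in boundary K -> (#|` s| <= k)%N.
Proof.
move=> /boundaryP[_ [t [c [/in_facesP[_ tk] st _ _ _]]]].
by apply: leq_trans (fsubset_leq_card st) _; rewrite tk.
Qed.

Lemma interiorP s j : s \in interior_faces K j <->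
  [/\ s \in K, #|` s| = j & s \notin boundary K].
Proof.
rewrite /interior_faces inE; split => [/andP[sb /in_facesP[]] //|[sK sj sb]].
by rewrite sb /=; apply/in_facesP.
Qed.

Lemma interior_cells : interior_faces K k.+1 = faces K k.+1.
Proof.
apply/fsetP => c; apply/idP/idP => [/interiorP[cK kc _]|/in_facesP[cK kc]].
  exact/in_facesP.
by apply/interiorP; split=> //; apply/negP => /boundary_card; rewrite kc ltnn.
Qed.

Lemma interior_facet_cells t c : t \in faces K k -> t \notin boundary K ->
  c \in faces K k.+1 -> t `<=` c ->
  exists c', [/\ c' \in faces K k.+1, t `<=` c' & c' != c].
Proof.
move=> tK tb cK tc; apply: contrapT => nc; case/negP: tb; apply/boundaryP.
split; first by move/in_facesP: tK => [].
exists t, c; split=> // c' c'K tc'.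
by apply: contrapT => /eqP c'c; apply: nc; exists c'.
Qed.

Lemma two_cells_interior t c c' : t \in faces K k ->
  c \in faces K k.+1 -> c' \in faces K k.+1 -> t `<=` c -> t `<=` c' ->
  c != c' -> t \notin boundary K.
Proof.
move=> /in_facesP[tK tk] cK cK' tc tc' cc'; apply/negP => /boundaryP[_].
move=> [f [d [/in_facesP[fK fk] tf dK fd ud]]].
have e : t = f by apply: face_eq; rewrite ?tk.
rewrite -e in ud; case/eqP: cc'.
by rewrite (ud _ cK tc) (ud _ cK' tc').
Qed.

(** The affine span of the facet separates the two cells: if the coordinate of
    [v2] in [c1] at [v1] were positive, a short move from the barycenter of
    the common facet towards [v2] would stay in both cells, outside their
    common face. *)
Lemma opposite_vertices c1 c2 v1 v2 :
  c1 \in faces K k.+1 -> c2 \in faces K k.+1 -> v1 \in c1 -> v2 \in c2 ->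
  c1 `\ v1 = c2 `\ v2 -> c1 `\ v1 != fset0 -> c1 != c2 -> bary c1 v2 v1 < 0.
Proof.
move=> c1K c2K v1c1 v2c2 e t0 c12.
have [ss1 ss2] := (cell_simplex c1K, cell_simplex c2K).
set t := c1 `\ v1 in e t0.
have tc1 : t `<=` c1 by exact: fsubD1set.
have tc2 : t `<=` c2 by rewrite e; exact: fsubD1set.
have v2t : v2 \notin t by rewrite e !inE eqxx.
have v1t : v1 \notin t by rewrite !inE eqxx.
have in1 u : u \in c1 -> u = v1 \/ u \in t.
  by move=> uc; have [->|uv] := eqVneq u v1; [left|right; rewrite !inE uv].
have in2 u : u \in c2 -> u = v2 \/ u \in t.
  by move=> uc; have [->|uv] := eqVneq u v2; [left|right; rewrite e !inE uv].
have v1c2 : v1 \notin c2.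
  apply/negP => /in2[v12|]; last by apply/negP.
  case/eqP: c12; rewrite -(fsetD1K v1c1) -(fsetD1K v2c2) -e -/t.
  by rewrite v12.
(* Since c1 and c2 differ, they meet exactly in the facet t. *)
have c12t : c1 `&` c2 = t.
  apply/eqP; rewrite eqEfsubset fsubsetI tc1 tc2 !andbT /=; apply/fsubsetP => u.
  rewrite inE => /andP[/in1[->|//]]; by rewrite (negPf v1c2).
have [[c1K' _] [c2K' _]] := ((in_facesP c1 _).1 c1K, (in_facesP c2 _).1 c2K).
have a0 := card_inv_gt0 t0; set a := (_^-1) in a0.
pose p := barycenter t.
(* Otherwise v2 would be in the affine span of t. *)
have b0 : bary c1 v2 v1 != 0.
  apply/eqP => b0; have [b1 bx] := baryP v2 ss1.
  have := aff_indep_uniq ss2.1 (w := fun u => (u == v2)%:R)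
    (w' := fun u => if u \in t then bary c1 v2 u else 0).
  have -> : \sum_(u <- c2) (u == v2)%:R = 1 :> R.
    rewrite (big_fsetD1 v2)//= eqxx big_seq big1 ?addr0// => u.
    by move=> /fsetD1P[/negPf ->].
  have -> : \sum_(u <- c2) (u == v2)%:R *: u = v2.
    rewrite (big_fsetD1 v2)//= eqxx scale1r big_seq big1 ?addr0// => u.
    by move=> /fsetD1P[/negPf ->]; rewrite scale0r.
  rewrite sum_zero_ext// sum_zero_ext_scale//.
  rewrite (big_fsetD1 v1)//= b0 add0r in b1.
  rewrite (big_fsetD1 v1)//= b0 scale0r add0r in bx.
  rewrite b1 bx => /(_ erefl erefl _ v2c2); rewrite eqxx (negPf v2t).
  by move/eqP; rewrite oner_eq0.
rewrite lt_neqAle b0 leNgt; apply/negP => b_gt0.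
have [e0 /andP[e0_gt0 e0_lt1] small] :=
  small_step c1 (bary c1 p) (bary c1 v2).
have e0lt : 0 < 1 - e0 by rewrite subr_gt0.
pose x := (1 - e0) *: p + e0 *: v2.
have x1 : hull c1 x.
  apply/(simplex_hullP _ ss1) => u uc1; rewrite bary_line//.
  have [->|ut] := in1 _ uc1.
    by rewrite bary_barycenter_sub// (negPf v1t) mulr0 add0r ltW// mulr_gt0.
  apply/ltW/small; rewrite ?e0_gt0 ?lexx//.
  by rewrite bary_barycenter_sub// ut.
have xv2 : bary c2 x v2 = e0.
  rewrite bary_line// bary_barycenter_sub// (negPf v2t) mulr0 add0r.
  by rewrite bary_vertex// eqxx mulr1.
have x2 : hull c2 x.
  apply/(simplex_hullP _ ss2) => u uc2.
  have [->|ut] := in2 _ uc2; first by rewrite xv2 ltW.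
  rewrite bary_line// bary_barycenter_sub// ut bary_vertex//.
  by rewrite addr_ge0// mulr_ge0 ?ler0n// ltW.
have : (hull c1 `&` hull c2)%classic x by [].
rewrite (sc_inter hK)// c12t => xt.
by have := bary_face ss2 tc2 xt v2c2 v2t; rewrite xv2 => /eqP; rewrite gt_eqF.
Qed.

(** Both sides are affine in [x], vanish on the facet opposite to [v], and
    agree at [v]. *)
Lemma side_bary s x v : full_simplex s -> v \in s ->
  side (s `\ v) x = bary s x v * side (s `\ v) v.
Proof.
move=> ss vs; have [b1 bx] := baryP x ss.
rewrite -{1}bx side_comb// (big_fsetD1 v)//= big_seq big1 ?addr0// => u us.
rewrite (side_vertex us) ?mulr0//.
by move: (cardfsD1 v s); rewrite vs ss.2 add1n => -[].
Qed.

Lemma incidence_opposite t c1 c2 : t \in faces K k ->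
  c1 \in faces K k.+1 -> c2 \in faces K k.+1 -> t `<=` c1 -> t `<=` c2 ->
  c1 != c2 -> incidence c1 t = - incidence c2 t.
Proof.
move=> /in_facesP[tK tk] c1K c2K tc1 tc2 c12.
have [ss1 ss2] := (cell_simplex c1K, cell_simplex c2K).
have [v1 v1c1 e1] := facet_vertex tc1 ss1.2 tk.
have [v2 v2c2 e2] := facet_vertex tc2 ss2.2 tk.
(* The affine function side t vanishes on t, so its value at v2 is its
   value at v1 times a negative number. *)
have b0 : bary c1 v2 v1 < 0.
  by apply: opposite_vertices c12; rewrite // -e1// face_neq0.
rewrite {2}e2 {1}e1 !incidence_facet ?ss1.2 ?ss2.2// -e2 e1 (side_bary v2 ss1)//.
by rewrite sgrM (ltr0_sg b0) mulN1r opprK.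
Qed.

(** Three incidence numbers cannot be pairwise opposite, since they are
    nonzero. *)
Lemma at_most_two_cells t c1 c2 c3 : t \in faces K k ->
  c1 \in faces K k.+1 -> c2 \in faces K k.+1 -> c3 \in faces K k.+1 ->
  t `<=` c1 -> t `<=` c2 -> t `<=` c3 -> c1 != c2 -> c1 != c3 -> c2 = c3.
Proof.
move=> tK c1K c2K c3K tc1 tc2 tc3 c12 c13; apply: contrapT => /eqP c23.
have e12 := incidence_opposite tK c1K c2K tc1 tc2 c12.
have e13 := incidence_opposite tK c1K c3K tc1 tc3 c13.
have e23 := incidence_opposite tK c2K c3K tc2 tc3 c23.
have : incidence c1 t = 0.
  move/eqP: e12; rewrite e23 opprK -[X in _ == X]opprK -e13 -addr_eq0 -mulr2n.
  by rewrite mulrn_eq0 => /eqP.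
have /in_facesP[_ tk] := tK; have ss1 := cell_simplex c1K.
have [v v1c1 ->] := facet_vertex tc1 ss1.2 tk.
rewrite incidence_facet ?ss1.2// => /eqP; rewrite sgr_eq0 => /eqP.
move=> s0; have := simplex_unitmx ss1; rewrite unitmxE (det_vertex_matrix v1c1 ss1.2).
by rewrite s0 mulr0 unitr0.
Qed.

End Complex.

(** * Geometry of simple subdivisions *)

Section Subdivision.
Local Open Scope fset_scope.
Local Open Scope ring_scope.
Variables (R : realType) (k : nat).
Local Notation point := 'rV[R]_k.
Local Notation face := {fset point}.
Implicit Types (g t c : face) (u v x : point).

(** If the barycenter of [t] were in the interior of [s], the points just
    beyond it, seen from the vertex [v] of [c] opposite to [t], would be
    covered by some cell [d]. By letting them tend to the barycenter, [d]
    contains [t], hence is [c]; but these points have a negative coordinate at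
    [v]. *)
Lemma boundary_subdivision (L : {fset {fset point}}) (s t c : face) :
  simplicial_complex L -> full_simplex s -> carrier L = hull s ->
  t \in faces L k -> c \in faces L k.+1 -> t `<=` c ->
  (forall c', c' \in faces L k.+1 -> t `<=` c' -> c' = c) ->
  exists2 v, v \in s & forall u, u \in t -> bary s u v = 0.
Proof.
move=> hL ss Ls /in_facesP[tL tk] cL tc uc.
have t0 := face_neq0 hL tL; have sc := cell_simplex hL cL.
have [v vc tE] := facet_vertex tc sc.2 tk.
have hull_s g u : g \in L -> hull g u -> hull s u.
  by move=> gL gu; rewrite -Ls; exists g.
(* q is the reflection of v in p; points of the segment from p to q are
   beyond t. *)
pose p := barycenter t; pose q : point := 2%:R *: p - v.
have tp : hull t p := barycenter_hull t0.
have bs_ge0 u w : u \in t -> w \in s -> 0 <= bary s u w.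
  move=> ut; have /(simplex_hullP _ ss) : hull s u; last exact.
  by apply: hull_s tL _; exact: hull_vertex.
have [[w ws pw]|np] := pselect (exists2 w, w \in s & bary s p w = 0).
  exists w => // u ut; apply/eqP; rewrite eq_le bs_ge0// andbT.
  move/eqP: pw; rewrite bary_barycenter// mulf_eq0 gt_eqF ?card_inv_gt0//=.
  move=> /eqP pw; rewrite -pw (big_fsetD1 u)//= lerDl.
  by rewrite big_seq sumr_ge0// => u' /fsetD1P[_ /bs_ge0 ->].
exfalso.
have ps w : w \in s -> 0 < bary s p w.
  move=> ws; rewrite lt_neqAle eq_sym; apply/andP; split.
    by apply/eqP => pw; apply: np; exists w.
  by move: (hull_s _ _ tL tp) => /(simplex_hullP _ ss); exact.
have [e1 /andP[e1_gt0 e1_lt1] small1] := small_step s (bary s p) (bary s q).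
pose r := [seq (d, w) | d <- enum_fset (faces L k.+1), w <- enum_fset d].
have [e2 /andP[e2_gt0 e2_lt1] small2] := small_step (I := (face * point)%type) r
  (fun dw => - bary dw.1 p dw.2) (fun dw => - bary dw.1 q dw.2).
pose e := Num.min e1 e2.
have e_gt0 : 0 < e by rewrite lt_min e1_gt0.
pose x := (1 - e) *: p + e *: q.
have : hull s x.
  apply/(simplex_hullP _ ss) => w ws; rewrite bary_line//.
  by apply/ltW/small1; rewrite ?e_gt0 ?ge_min ?lexx//; exact: ps.
rewrite -Ls => /(carrier_cell hL)[d dL dx]; have sd := cell_simplex hL dL.
(* A negative coordinate of p would be negative at x too, by the choice
   of e. *)
have dp : hull d p.
  apply/(simplex_hullP _ sd) => w wd; rewrite leNgt; apply/negP => pw.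
  have : 0 <= bary d x w by move: dx => /(simplex_hullP _ sd); exact.
  rewrite bary_line// leNgt => /negP; apply.
  rewrite -oppr_gt0 opprD -!mulrN.
  apply: (small2 e _ (d, w)); rewrite ?e_gt0 ?ge_min ?lexx ?orbT ?oppr_gt0//.
  by apply: (@allpairs_f_dep _ _ (face * point)%type (fun d w => (d, w)) _
    (fun d : face => enum_fset d)).
have [dL' _] := (in_facesP _ _ _).1 dL.
have td : t `<=` d.
  have : (hull d `&` hull t)%classic p by [].
  rewrite (sc_inter hL)// => /(hull_barycenter (sc_indep hL tL) (fsubsetIr _ _) t0).
  by move=> <-; exact: fsubsetIl.
have := uc _ dL td => dc; rewrite {}dc in dx sd td dp dL dL'.
have : 0 <= bary c x v by move: dx => /(simplex_hullP _ sc); exact.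
have pv : bary c p v = 0 by rewrite bary_barycenter_sub// tE !inE eqxx.
have qE : q = (1 - (- 1)) *: p + (- 1) *: v by rewrite opprK scaleN1r.
rewrite bary_line// pv mulr0 add0r qE bary_line// pv bary_vertex// eqxx.
by rewrite mulr0 add0r mulr1 mulrN1 oppr_ge0 leNgt e_gt0.
Qed.

Section Simple.
Variables (D L D' : {fset {fset point}}) (s : face).
Hypotheses (hD : simplicial_complex D) (hS : simple_subdivision D s L D').

Let hL := ss_complex hS.
Let hD' := ss_result hS.
Let sD := ss_cell hS.
Let ss := cell_simplex hD sD.
Let s_face : s \in D. Proof. by case/in_facesP: sD. Qed.

Lemma new_face_hull g v : g \in L -> v \in g -> hull s v.
Proof. by move=> gL vg; rewrite -(ss_carrier hS); exists g => //; exact: hull_vertex. Qed.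

Lemma sub_new_face g c : g \in D -> c \in L -> g `<=` c -> g `<=` s.
Proof.
move=> gD cL gc; apply: (complex_sub hD) => // v vg.
by apply: new_face_hull cL _; exact: (fsubsetP gc).
Qed.

Lemma old_cell_notin_new c : c \in faces D k.+1 -> c != s -> c \notin L.
Proof.
move=> /in_facesP[cD ck] cs; apply/negP => cL; case/eqP: cs.
by apply: face_eq; [exact: sub_new_face cL _|rewrite ck ss.2].
Qed.

Lemma new_subset g : g \in L -> g \in D'.
Proof. by move=> gL; apply/(ss_faces hS); left. Qed.

Lemma old_subset c g : c \in faces D k.+1 -> c != s -> g `<=` c -> g != fset0 ->
  g \in D'.
Proof. by move=> cD cs gc g0; apply/(ss_faces hS); right; split=> //; exists c. Qed.

Lemma new_cell c : c \in faces L k.+1 -> c \in faces D' k.+1.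
Proof. by move=> /in_facesP[cL ck]; apply/in_facesP; split => //; exact: new_subset. Qed.

Lemma old_cell c : c \in faces D k.+1 -> c != s -> c \in faces D' k.+1.
Proof.
move=> cD cs; have /in_facesP[cD_ ck] := cD.
by apply/in_facesP; split => //; apply: old_subset cD cs _ _; rewrite ?(face_neq0 hD).
Qed.

Lemma subdivision_cellP c : c \in faces D' k.+1 ->
  c \in faces L k.+1 \/ c \in faces D k.+1 /\ c != s.
Proof.
move=> /in_facesP[/(ss_faces hS)[cL|[_ [t [tD ts ct]]]] ck].
  by left; apply/in_facesP.
have /in_facesP[_ tk] := tD.
by right; rewrite (face_eq ct) ?ck.
Qed.

Lemma sub_two_cells g c : g \in L -> c \in faces D k.+1 -> c != s -> g `<=` c ->
  g `<=` s.
Proof.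
move=> gL cD cs gc; have /in_facesP[cD_ ck] := cD.
have g0 := face_neq0 hL gL.
by apply: sub_new_face gL _ => //; exact: (sc_closed hD cD_).
Qed.

Lemma interior_face_new g j : g \in interior_faces D j -> g `<` s ->
  g \in boundary L.
Proof. by move=> gD /(ss_boundary hS (ex_intro _ j gD)). Qed.

Lemma new_cell_over g : g \in boundary L -> exists2 c, c \in faces L k.+1 & g `<=` c.
Proof. by move=> /boundaryP[gL _]; exact: face_cell. Qed.

Lemma proper_card g t : g `<=` t -> (#|` g| < #|` t|)%N -> g `<` t.
Proof.
by move=> gt lt_gt; rewrite fproperEcard gt.
Qed.

(** Suppose that [g] is interior in [D] but in a boundary facet [t] of [D'].
    If the only cell of [D'] over [t] comes from [D], then so does [t], and
    the second cell of [D] over [t] leaves a second cell in [D'], namely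
    itself or a part of [s]. If that cell is part of [s], then [t] is in the
    hull of a facet of [s] that contains [g]; this facet is interior in [D],
    hence not subdivided and equal to [t], and the cell of [D] behind it is a
    second cell over [t]. *)
Lemma interior_face_subdivision j g : (j <= k)%N ->
  g \in interior_faces D j -> g \in interior_faces D' j.
Proof.
move=> jk gD; have /interiorP[gD_ gj gb] := gD; have g0 := face_neq0 hD gD_.
have gs : g `<=` s -> g `<` s.
  by move=> gs; apply: proper_card => //; rewrite gj ss.2.
apply/interiorP; split=> //.
  have [c cD gc] := face_cell hD gD_; have [cs|cs] := eqVneq c s.
    rewrite cs in gc; apply: new_subset.
    by have /boundaryP[] := interior_face_new gD (gs gc).
  exact: old_subset cs gc g0.
apply/negP => /boundaryP[gD' [t [c [tD' gt cD' tc uc]]]].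
have /in_facesP[tD'_ tk] := tD'.
have [cL|[cD cs]] := subdivision_cellP cD'; last first.
  have /in_facesP[cD_ _] := cD.
  have t0 := face_neq0 hD' tD'_; have tD_ := sc_closed hD cD_ tc t0.
  have tD : t \in faces D k by apply/in_facesP.
  have tb : t \notin boundary D by apply/negP => /(boundary_face gD_ gt); apply/negP.
  have [c' [c'D tc' c'c]] := interior_facet_cells tD tb cD tc.
  have [c's|c's] := eqVneq c' s; last first.
    by case/eqP: c'c; apply: uc tc'; exact: old_cell.
  have ts : t `<` s by apply: proper_card; rewrite -?c's// tk c's ss.2.
  have tint : t \in interior_faces D k by apply/interiorP.
  have [d dL td] := new_cell_over (interior_face_new tint ts).
  have dc := uc d (new_cell dL) td; rewrite dc in dL.
  have [dL_ _] := (in_facesP _ _ _).1 dL.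
  by move: (old_cell_notin_new cD cs); rewrite dL_.
have /in_facesP[cL_ ck] := cL; have tL_ := sc_closed hL cL_ tc (face_neq0 hD' tD'_).
have tL : t \in faces L k by apply/in_facesP.
have [v vs tv] := boundary_subdivision hL ss (ss_carrier hS) tL cL tc
  (fun c' c'L => uc c' (new_cell c'L)).
have gsv : g `<=` s `\ v.
  have sv0 : s `\ v != fset0.
    have /fset0Pn[u ug] := g0; have ut := fsubsetP gt _ ug.
    apply/eqP => sv; have := hull_facet ss vs (new_face_hull tL_ ut) (tv _ ut).
    by rewrite sv; exact: hull0.
  apply: (complex_sub hD) => //; first exact: sc_closed s_face (fsubD1set _ _) sv0.
  move=> u ug; have ut := fsubsetP gt _ ug.
  by apply: hull_facet ss vs _ (tv _ ut); exact: new_face_hull ut.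
have sv0 : s `\ v != fset0 by exact: fsubset_neq0 gsv g0.
have svs := fsubD1set s v.
have svD_ : s `\ v \in D := sc_closed hD s_face svs sv0.
have svk : #|` s `\ v| = k by move: (cardfsD1 v s); rewrite vs ss.2 add1n => -[].
have svD : s `\ v \in faces D k by apply/in_facesP.
have svb : s `\ v \notin boundary D by apply/negP => /(boundary_face gD_ gsv); apply/negP.
have [c' [c'D svc' c's]] := interior_facet_cells svD svb sD svs.
have svint : s `\ v \in interior_faces D k by apply/interiorP.
have /boundaryP[svL _] : s `\ v \in boundary L.
  by apply: interior_face_new svint _; apply: proper_card; rewrite // svk ss.2.
(* The facet s \ v is itself a face of L, so it cannot be split further. *)
have tsv : t = s `\ v.
  apply: face_eq; rewrite ?svk ?tk//; apply: (complex_sub hL) => // u ut.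
  by apply: hull_facet ss vs _ (tv _ ut); exact: new_face_hull ut.
have c'c : c' = c by apply: uc; [exact: old_cell|rewrite tsv].
by move: (old_cell_notin_new c'D c's); rewrite c'c cL_.
Qed.

Lemma hull_in_subdivided c : c \in faces D' k.+1 ->
  (hull c `<=` hull s)%classic <-> c \in L.
Proof.
move=> cD'; split => [cs|cL x cx]; last by rewrite -(ss_carrier hS); exists c.
have [/in_facesP[] //|[cD c's]] := subdivision_cellP cD'.
have /in_facesP[cD_ ck] := cD; case/eqP: c's; apply: face_eq; rewrite ?ck ?ss.2//.
by apply: (complex_sub hD) => // v vc; apply: cs; exact: hull_vertex.
Qed.

(** A cell of the subdivision of [s] that is also in [c] would lie in the
    common face of [s] and [c], in the zero set of a barycentric coordinate of
    [s]. *)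
Lemma hull_in_old c c' : c \in faces D k.+1 -> c != s -> c' \in faces D' k.+1 ->
  (hull c' `<=` hull c)%classic <-> c' = c.
Proof.
move=> cD cs c'D'; split => [c'c|-> //]; have /in_facesP[cD_ ck] := cD.
have [c'L|[c'D _]] := subdivision_cellP c'D'; last first.
  have /in_facesP[c'D_ c'k] := c'D; apply: face_eq; rewrite ?ck ?c'k//.
  by apply: (complex_sub hD) => // v vc; apply: c'c; exact: hull_vertex.
have /in_facesP[c'L_ _] := c'L.
have /fsubsetPn[w ws wc] : ~~ (s `<=` c).
  by apply/negP => sc; case/eqP: cs; rewrite (face_eq sc) ?ck ?ss.2.
have [u uc' /eqP u_neq0] := simplex_not_in_face_span ss (cell_simplex hD' c'D') ws.
case: u_neq0.
have : (hull s `&` hull c)%classic u.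
  by split; [exact: new_face_hull uc'|apply: c'c; exact: hull_vertex].
rewrite (sc_inter hD)// => usc.
by apply: (bary_face ss (fsubsetIl _ _) usc ws); rewrite inE ws.
Qed.

(** A cell of [D'] inside [c] and no other cell of [D] is what recovers the
    coefficient at [c] of a chain from its image. *)
Lemma own_cell c : c \in faces D k.+1 -> exists2 c', c' \in faces D' k.+1 &
  forall c2, c2 \in faces D k.+1 -> (hull c' `<=` hull c2)%classic <-> c2 = c.
Proof.
move=> cD; have [->|cs] := eqVneq c s; last first.
  exists c => [|c2 c2D]; first exact: old_cell.
  have [->|c2s] := eqVneq c2 s; last by rewrite hull_in_old ?old_cell//; split=> ->.
  rewrite hull_in_subdivided ?old_cell//; split=> [cL|e]; last by rewrite e eqxx in cs.
  by move: (old_cell_notin_new cD cs); rewrite cL.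
have s0 := face_neq0 hD s_face.
have : carrier L (barycenter s) by rewrite (ss_carrier hS); exact: barycenter_hull.
move=> /(carrier_cell hL)[c' c'L _]; have c'D' := new_cell c'L.
have /in_facesP[c'L_ _] := c'L; exists c' => // c2 c2D.
have [->|c2s] := eqVneq c2 s; first by rewrite hull_in_subdivided.
rewrite hull_in_old//; split => [e|e]; last by rewrite e eqxx in c2s.
by move: (old_cell_notin_new c2D c2s); rewrite -e c'L_.
Qed.

(** A second cell outside [s] would make the facet a common face of two cells
    of [D], hence an interior facet of [D]. *)
Lemma new_facet_interior t : t \in interior_faces D' k -> t \in L ->
  t \notin interior_faces D k ->
  forall c, c \in faces L k.+1 -> t `<=` c -> exists c',
    [/\ c' \in faces L k.+1, t `<=` c' & c' != c].
Proof.
move=> /interiorP[tD' tk tb] tL tD c cL tc.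
have tD'k : t \in faces D' k by apply/in_facesP.
have [c' [c'D' tc' c'c]] := interior_facet_cells tD'k tb (new_cell cL) tc.
have [c'L|[c'D c's]] := subdivision_cellP c'D'; first by exists c'.
case/negP: tD; have /in_facesP[c'D_ _] := c'D.
have tD : t \in D := sc_closed hD c'D_ tc' (face_neq0 hL tL).
have tDk : t \in faces D k by apply/in_facesP.
apply/interiorP; split => //; apply: (two_cells_interior tDk c'D sD tc' _ c's).
exact: sub_two_cells tL c'D c's tc'.
Qed.

(** The cells into which [c] is subdivided have as total boundary the boundary
    of [c], up to facets in the boundary of [D']. Inside [c], the two cells
    over a new facet cancel. On an interior facet of [D] there is exactly one
    cell of the subdivision, on the same side as [c], so that the incidence
    numbers agree. *)
Lemma refine_incidence c t : c \in faces D k.+1 -> t \in interior_faces D' k ->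
  \sum_(c' <- faces D' k.+1 | `[< (hull c' `<=` hull c)%classic >])
     incidence c' t = if t \in interior_faces D k then incidence c t else 0.
Proof.
move=> cD tD'; have /interiorP[tD'_ tk tb'] := tD'.
have tD'k : t \in faces D' k by apply/in_facesP.
have [cs|cs] := eqVneq c s; last first.
  have cD' := old_cell cD cs; have /in_facesP[cD_ _] := cD.
  rewrite big_mkcond (big_fsetD1 c)//= asboolT// big_seq big1 ?addr0; last first.
    move=> c' /fsetD1P[c'c c'D']; case: asboolP => // /(hull_in_old cD cs c'D') e.
    by rewrite e eqxx in c'c.
  case: ifPn => // tD; have [tc|/incidence_notsub //] := boolP (t `<=` c).
  have tD_ := sc_closed hD cD_ tc (face_neq0 hD' tD'_).
  have tDk : t \in faces D k by apply/in_facesP.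
  have [c' [c'D' tc' c'c]] := interior_facet_cells tD'k tb' cD' tc.
  case/negP: tD; apply/interiorP; split=> //.
  have [c'L|[c'D _]] := subdivision_cellP c'D'; last first.
    exact: two_cells_interior tDk c'D cD tc' tc c'c.
  apply: (two_cells_interior tDk sD cD _ tc); last by rewrite eq_sym.
  by have /in_facesP[c'L_ _] := c'L; exact: sub_new_face tD_ c'L_ tc'.
rewrite {c}cs in cD *.
have -> : \sum_(c <- faces D' k.+1 | `[< (hull c `<=` hull s)%classic >])
    incidence c t = \sum_(c <- faces L k.+1) incidence c t.
  have LD' : faces L k.+1 `<=` faces D' k.+1 by apply/fsubsetP => c; exact: new_cell.
  rewrite big_mkcond -(big_fset_incl _ LD') => [|c cD' cL].
    rewrite big_seq [RHS]big_seq; apply: eq_bigr => c cL.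
    rewrite asboolT//; apply/(hull_in_subdivided (new_cell cL)).
    by have /in_facesP[] := cL.
  case: asboolP => // /(hull_in_subdivided cD') cL_.
  by case/negP: cL; have /in_facesP[_ ck] := cD'; exact/in_facesP.
have zero : (forall c, c \in faces L k.+1 -> ~~ (t `<=` c)) ->
    \sum_(c <- faces L k.+1) incidence c t = 0.
  by move=> nt; rewrite big_seq big1// => c /nt /incidence_notsub.
have [tL|tL] := boolP (t \in L); last first.
  have nt c : c \in faces L k.+1 -> ~~ (t `<=` c).
    move=> /in_facesP[cL _]; apply: contra tL => tc.
    exact: (sc_closed hL cL tc (face_neq0 hD' tD'_)).
  rewrite zero//; case: ifPn => // tD; have [ts|/incidence_notsub //] := boolP (t `<=` s).
  case/negP: tL; have [] // := (boundaryP L t).1 (interior_face_new tD _).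
  by apply: proper_card => //; rewrite tk ss.2.
have tLk : t \in faces L k by apply/in_facesP.
have [c cL tc] := face_cell hL tL.
have [tD|tD] := boolP (t \in interior_faces D k); last first.
  have [c' [c'L tc' c'c]] := new_facet_interior tD' tL tD cL tc.
  rewrite (big_fsetD1 c)//= (big_fsetD1 c')/=; last by apply/fsetD1P.
  rewrite big_seq big1 ?addr0 => [|d /fsetD1P[dc' /fsetD1P[dc dL]]].
    by rewrite (incidence_opposite hL tLk c'L cL)// subrr.
  apply: incidence_notsub; apply/negP => td; case/eqP: dc'.
  by apply: (at_most_two_cells hL tLk cL dL c'L); rewrite // eq_sym.
have ts : t `<=` s.
  have /in_facesP[cL_ _] := cL; have /interiorP[tD_ _ _] := tD.
  exact: sub_new_face tD_ cL_ tc.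
have [v vs tE] := facet_vertex ts ss.2 tk.
have sc := cell_simplex hL cL; have [w wc tEw] := facet_vertex tc sc.2 tk.
(* w is in the hull of s, and not in the span of t, so it is on the same
   side of t as v. *)
have w_gt0 : 0 < bary s w v.
  have /in_facesP[cL_ _] := cL.
  rewrite lt_neqAle eq_sym; apply/andP; split; last first.
    by move: (new_face_hull cL_ wc) => /(simplex_hullP _ ss); exact.
  apply/eqP => w0; have := simplex_unitmx sc.
  rewrite unitmxE (det_vertex_matrix wc sc.2) -tEw tE (side_bary w ss vs) w0.
  by rewrite mul0r mulr0 unitr0.
rewrite (big_fsetD1 c)//= big_seq big1 ?addr0 => [|d /fsetD1P[dc dL]].
  have -> : incidence c t = Num.sg (side t w).
    by rewrite tEw (incidence_facet wc sc.2).
  have -> : incidence s t = Num.sg (side t v).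
    by rewrite tE (incidence_facet vs ss.2).
  by rewrite tE (side_bary w ss vs) sgrM (gtr0_sg w_gt0) mul1r.
apply: incidence_notsub; apply/negP => td.
have /negP[] := two_cells_interior tLk dL cL td tc dc.
by apply: interior_face_new tD _; apply: proper_card; rewrite // tk ss.2.
Qed.

End Simple.
End Subdivision.

(** * The chain complexes and the exact sequence *)

Section Quotients.
Variables (A : nzRingType) (V : lmodType A).

Lemma gen_submodule (E : set V) : E 0 -> (forall x y, E x -> E y -> E (x + y)) ->
  (forall a x, E x -> E (a *: x)) -> forall x, x \in gen E <-> E x.
Proof.
move=> E0 ED EZ x; split => [/asboolP[s Es ->]|Ex].
  by rewrite big_seq; elim/big_ind: _ => // p ps; apply/EZ/Es.
apply/asboolP; exists [:: (1, x)]; last by rewrite big_seq1 scale1r.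
by move=> p /[!inE]/eqP ->.
Qed.

Lemma mem_gen (E : set V) x : E x -> x \in gen E.
Proof.
move=> Ex; apply/asboolP; exists [:: (1, x)]; last by rewrite big_seq1 scale1r.
by move=> p /[!inE]/eqP ->.
Qed.

Lemma modq_pi0 (E : set V) x : modq_pi E x = 0 <-> x \in gen E.
Proof. by rewrite -(linear0 (modq_pi E)) modq_piP subr0. Qed.

Lemma modq_surj (E : set V) (x : modq E) : exists c, x = modq_pi E c.
Proof. by exists (modq_repr x); rewrite modq_reprK. Qed.

End Quotients.

Section InducedMaps.
Variables (A : nzRingType) (V W : lmodType A).

Lemma induced_linear (E : set V) (E' : set W) (f : {linear V -> W}) :
  (forall x, E x -> f x \in gen E') -> linear (induced E E' f).
Proof.
move=> fE a x y; have [[c ->] [d ->]] := (modq_surj x, modq_surj y).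
by rewrite -linearP !inducedE// !linearP.
Qed.

(** The range of a linear map is already a submodule. *)
Lemma range_modq (f : V -> W) : linear f ->
  forall x, modq_pi (range f) x = 0 <-> exists y, f y = x.
Proof.
move=> lf x; pose F : {linear V -> W} :=
  HB.pack f (GRing.isLinear.Build A V W *:%R f lf).
apply: iff_trans (modq_pi0 _ _) _; apply: iff_trans (gen_submodule _ _ _ _) _.
- by exists 0 => //; exact: (linear0 F).
- by move=> _ _ [y _ <-] [z _ <-]; exists (y + z) => //; exact: (linearD F).
- by move=> a _ [y _ <-]; exists (a *: y) => //; exact: (linearZ_LR F).
- by split=> -[y]; exists y.
Qed.

End InducedMaps.

Section Chains.
Local Open Scope fset_scope.
Local Open Scope ring_scope.
Variables (R : realType) (k r : nat).
Local Notation point := 'rV[R]_k.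
Local Notation face := {fset point}.
Local Notation complex := {fset {fset point}}.
Implicit Types (K : complex).
Arguments J_chain {R k} r K j c.

Lemma J_mono K K' (s s' : face) :
  (forall t, t \in faces K k -> s `<=` t -> t \in faces K' k /\ s' `<=` t) ->
  {subset J r K s <= J r K' s'}.
Proof.
move=> KK' p /asboolP[q qJ ->]; apply/asboolP; exists q => // x /qJ.
move=> [t [l [tK st tl xl]]]; have [tK' s't] := KK' _ tK st.
by exists t, l.
Qed.

(** No facet contains a cell, so the ideal has no generators. *)
Lemma J_cell K (s : face) p : #|` s| = k.+1 -> p \in J r K s -> p = 0.
Proof.
move=> sk /asboolP[[|x q] qJ ->]; first by rewrite big_nil.
have [t [l []]] := qJ _ (mem_head _ _).
by rewrite !inE => /andP[_ /eqP tk] /fsubset_leq_card; rewrite sk tk ltnn.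
Qed.

Lemma gen_J_chain K j (c : free_chain K j) :
  c \in gen (J_chain r K j) <-> J_chain r K j c.
Proof.
apply: gen_submodule => [s|x y Jx Jy s|a x Jx s]; rewrite ffunE ?rpred0//.
  by rewrite rpredD.
by rewrite rpredZ.
Qed.

Lemma chain_eq K j (c d : free_chain K j) :
  modq_pi (J_chain r K j) c = modq_pi (J_chain r K j) d <->
  forall s, c s - d s \in J r K (val s).
Proof.
rewrite modq_piP gen_J_chain; split=> cd s; have := cd s; rewrite !ffunE//.
Qed.

Lemma chain_eq0 K j (c : free_chain K j) :
  modq_pi (J_chain r K j) c = 0 <-> forall s, c s \in J r K (val s).
Proof. by rewrite modq_pi0 gen_J_chain. Qed.

Lemma top_chain_inj K : injective (modq_pi (J_chain r K k.+1)).
Proof.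
move=> c d /chain_eq cd; apply/ffunP => s; apply/eqP; rewrite -subr_eq0; apply/eqP.
by apply: J_cell (cd s); have := valP s; rewrite !inE => /andP[_ /andP[_ /eqP]].
Qed.

Local Notation bd K j := (@free_map R k K K j j.-1 (@incidence R k)).
Local Notation subdiv D D' j := (@free_map R k D D' j j (@subdiv_coef R k)).

Lemma diffE K j (c : free_chain K j) :
  diff (modq_pi (J_chain r K j) c) = modq_pi (J_chain r K j.-1) (bd K j c).
Proof. by apply: inducedE => x; exact: boundary_descends. Qed.

Lemma diff_linear K j : linear (@diff R k r K j).
Proof. by apply: induced_linear => x; exact: boundary_descends. Qed.

Lemma free_map_comp K1 K2 K3 i1 i2 i3 (m1 m2 : face -> face -> R)
    (c : free_chain K1 i1) :
  @free_map R k K2 K3 i2 i3 m2 (@free_map R k K1 K2 i1 i2 m1 c) =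
  free_map K3 i3 (fun s t => \sum_(u <- interior_faces K2 i2) m1 s u * m2 u t) c.
Proof.
apply/ffunP => t; rewrite !ffunE.
under eq_bigr do rewrite ffunE mulr_sumr.
rewrite exchange_big; apply: eq_bigr => s _ /=.
rewrite big_seq_fsetE (raddf_sum (@mpolyC k.+1 R)) mulr_suml.
by apply: eq_bigr => u _; rewrite mulrA -mpolyCM [m1 _ _ * _]mulrC.
Qed.

Lemma eq_free_map K K' i j (m m' : face -> face -> R) :
  (forall s t, s \in interior_faces K i -> t \in interior_faces K' j ->
    m s t = m' s t) ->
  forall c, @free_map R k K K' i j m c = @free_map R k K K' i j m' c.
Proof.
move=> mm c; apply/ffunP => t; rewrite !ffunE; apply: eq_bigr => s _.
by rewrite mm// (valP s, valP t).
Qed.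

Lemma free_map0 K K' i j (c : free_chain K i) :
  @free_map R k K K' i j (fun _ _ => 0) c = 0.
Proof.
by apply/ffunP => t; rewrite !ffunE big1// => s _; rewrite mpolyC0 mul0r.
Qed.

(** A face between an interior face and a cell is interior, so the
    cancellation of signs for simplices is not affected by leaving out the
    boundary. *)
Lemma diff_diff K : simplicial_complex K ->
  forall x : chain r K k.+1, diff (diff x) = 0.
Proof.
move=> hK x; have [c ->] := modq_surj x.
rewrite !diffE free_map_comp (eq_free_map (m' := fun _ _ => 0)).
  by rewrite free_map0 linear0.
move=> s g /interiorP[sK sk sb] /interiorP[gK gk gb].
apply: boundary_boundary => [v vs gs|t /interiorP[_ tk _]].
  have svK : s `\ v \in K.
    apply: (sc_closed hK sK (fsubD1set _ _)).
    exact: fsubset_neq0 gs (face_neq0 hK gK).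
  apply/interiorP; split => //.
    by move: (cardfsD1 v s); rewrite vs sk add1n => -[].
  by apply: contra gb; exact: boundary_face.
by rewrite /orient tk eqn_leq ltnn andbF.
Qed.

Section Subdivided.
Variables (D D' L : complex) (s0 : face).
Hypotheses (hD : simplicial_complex D) (hS : simple_subdivision D s0 L D').
Hypothesis hJ : forall g, g \in boundary L -> g \notin boundary D' ->
  J r D' g =i J r D g.

Lemma interior_cell_card K c : c \in interior_faces K k.+1 -> #|` c| = k.+1.
Proof. by move=> /interiorP[]. Qed.

(** A facet is contained in no other facet, so its ideal has the powers of the
    forms of this facet as generators. *)
Lemma facet_J K K' t : t \in faces K k -> t \in faces K' k ->
  {subset J r K t <= J r K' t}.
Proof.
move=> /in_facesP[_ tk] tK'; apply: J_mono => u /in_facesP[_ uk] tu.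
by rewrite -(face_eq tu) ?uk.
Qed.

Lemma interior_faces_sub K j t : t \in interior_faces K j -> t \in faces K j.
Proof. by move=> /interiorP[? ? _]; apply/in_facesP. Qed.

Lemma subdiv_interior (j : nat) (c : free_chain D j) t : (j <= k)%N ->
  forall (tD : val t \in interior_faces D j),
  subdiv D D' j c t = c [` tD].
Proof.
move=> jk tD; rewrite ffunE (bigD1 [` tD])//= big1 ?addr0 => [|u ut].
  have /interiorP[_ tj _] := tD.
  by rewrite /subdiv_coef tj ltn_eqF// eqxx mpolyC1 mul1r.
have /interiorP[_ uj _] := valP u.
rewrite /subdiv_coef uj ltn_eqF// (_ : _ == _ = false) ?mpolyC0 ?mul0r//.
by apply: contraNF ut => /eqP tu; apply/eqP/val_inj.
Qed.

Lemma subdiv_not_interior (j : nat) (c : free_chain D j) t : (j <= k)%N ->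
  val t \notin interior_faces D j -> subdiv D D' j c t = 0.
Proof.
move=> jk tD; rewrite ffunE big1// => u _.
have /interiorP[_ uj _] := valP u.
rewrite /subdiv_coef uj ltn_eqF// (_ : _ == _ = false) ?mpolyC0 ?mul0r//.
by apply: contraNF tD => /eqP ->; exact: valP.
Qed.

Lemma subdiv_facets_descends (c : free_chain D k) :
  J_chain r D k c -> subdiv D D' k c \in gen (J_chain r D' k).
Proof.
move=> Jc; apply/gen_J_chain => t.
have [tD|tD] := boolP (val t \in interior_faces D k); last first.
  by rewrite subdiv_not_interior// rpred0.
rewrite (subdiv_interior c (leqnn k) tD); have := Jc [` tD].
exact: (facet_J (interior_faces_sub tD) (interior_faces_sub (valP t))).
Qed.

Lemma subdiv_cells_descends (c : free_chain D k.+1) :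
  J_chain r D k.+1 c -> subdiv D D' k.+1 c \in gen (J_chain r D' k.+1).
Proof.
move=> /chain_eq0; rewrite -(linear0 (modq_pi _)) => /top_chain_inj ->.
by rewrite linear0 rpred0.
Qed.

Lemma taut_cells_linear : linear (taut r D D' k.+1).
Proof. exact: induced_linear subdiv_cells_descends. Qed.

Lemma taut_facets_linear : linear (taut r D D' k).
Proof. exact: induced_linear subdiv_facets_descends. Qed.

Lemma taut_cellsE (c : free_chain D k.+1) :
  taut r D D' k.+1 (modq_pi _ c) = modq_pi _ (subdiv D D' k.+1 c).
Proof. exact: inducedE subdiv_cells_descends _. Qed.

Lemma taut_facetsE (c : free_chain D k) :
  taut r D D' k (modq_pi _ c) = modq_pi _ (subdiv D D' k c).
Proof. exact: inducedE subdiv_facets_descends _. Qed.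

(** Coefficientwise this is [refine_incidence]. *)
Lemma taut_diff (x : chain r D k.+1) :
  diff (taut r D D' k.+1 x) = taut r D D' k (diff x) :> chain r D' k.
Proof.
have [c ->] := modq_surj x.
rewrite taut_cellsE !diffE taut_facetsE !free_map_comp; congr modq_pi.
apply: eq_free_map => s t sD tD'; have sk := interior_cell_card sD.
have s_face := interior_faces_sub sD.
transitivity (if t \in interior_faces D k then incidence s t else 0).
  rewrite -(refine_incidence hD hS s_face tD') [RHS]big_mkcond interior_cells.
  apply: eq_bigr => u _; rewrite /subdiv_coef sk eqxx.
  by case: asboolP => _; rewrite ?mul1r ?mul0r.
have coefE u : u \in interior_faces D k -> subdiv_coef u t = (t == u)%:R :> R.
  by move=> /interiorP[_ uk _]; rewrite /subdiv_coef uk ltn_eqF.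
case: ifPn => tD.
  rewrite (big_fsetD1 t)//= big_seq big1 ?addr0 => [|u /fsetD1P[ut uD]].
    by rewrite coefE// eqxx mulr1.
  by rewrite coefE// eq_sym (negPf ut) mulr0.
rewrite big_seq big1// => u uD; rewrite coefE//.
by case: eqP => [tu|_]; rewrite ?mulr0//; rewrite tu uD in tD.
Qed.

Lemma subdiv_own_cell (s : interior_faces D k.+1) : exists t : interior_faces D' k.+1,
  forall c : free_chain D k.+1, subdiv D D' k.+1 c t = c s.
Proof.
have sD := interior_faces_sub (valP s).
have [t tD' own] := own_cell hD hS sD; have tD'i := tD'.
rewrite -interior_cells in tD'i; exists [` tD'i] => c.
rewrite ffunE (bigD1 s)//= big1 ?addr0 => [|u us];
  rewrite /subdiv_coef (interior_cell_card (valP _)) eqxx /=.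
  by rewrite asboolT ?mpolyC1 ?mul1r//; apply/own.
rewrite asboolF ?mpolyC0 ?mul0r// => /own; move=> /(_ (interior_faces_sub (valP u))).
by move=> /val_inj us'; rewrite us' eqxx in us.
Qed.

Lemma subdiv_cells_inj : injective (subdiv D D' k.+1).
Proof.
move=> c d cd; apply/ffunP => s; have [t tE] := subdiv_own_cell s.
by rewrite -!tE cd.
Qed.

Lemma taut_cells_inj : injective (taut r D D' k.+1).
Proof.
move=> x y; have [[c ->] [d ->]] := (modq_surj x, modq_surj y).
by rewrite !taut_cellsE => /top_chain_inj /subdiv_cells_inj ->.
Qed.

Lemma taut_facets_inj x : taut r D D' k x = 0 -> x = 0.
Proof.
have [c ->] := modq_surj x; rewrite taut_facetsE => /chain_eq0 Jc.
apply/chain_eq0 => s.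
have sD' := interior_face_subdivision hD hS (leqnn k) (valP s).
have sE : [` valP s] = s by exact: val_inj.
have := Jc [` sD']; rewrite (subdiv_interior (t := [` sD']) c (leqnn k) (valP s)) sE.
exact: (facet_J (interior_faces_sub sD') (interior_faces_sub (valP s))).
Qed.

(** For a face of [s] this is the split condition; the facets over any other
    face are not affected by the subdivision. *)
Lemma split_J g j : (j <= k)%N -> g \in interior_faces D j ->
  {subset J r D' g <= J r D g}.
Proof.
move=> jk gD; have /interiorP[gD_ gj gb] := gD.
have ss := cell_simplex hD (ss_cell hS).
have [gs|gs] := boolP (g `<=` s0).
  move=> p; rewrite hJ//; last first.
    by have /interiorP[] := interior_face_subdivision hD hS jk gD.
  apply: (interior_face_new hS gD); apply: proper_card => //.
  by rewrite gj ss.2.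
apply: J_mono => t /in_facesP[tD' tk] gt; split => //.
have [tL|[_ [c [cD cs tc]]]] := (ss_faces hS t).1 tD'.
  by case/negP: gs; exact: (sub_new_face hD hS gD_ tL gt).
have /in_facesP[cD_ _] := cD.
apply/in_facesP; split=> //; apply: (sc_closed hD cD_ tc).
exact: fsubset_neq0 gt (face_neq0 hD gD_).
Qed.

(** The boundary of [taut y] is zero, being the boundary of a boundary. Over
    an interior face [g] of [D] it has the same coefficient as the boundary of
    [y], which is therefore in the ideal of [g] for [D'], hence in that for
    [D]. *)
Lemma lifted_boundary_cycle (x : chain r D' k.+1) (y : chain r D k) :
  diff x = taut r D D' k y -> diff y = 0.
Proof.
move=> xy; have := diff_diff (ss_result hS) x; rewrite xy.
have [b ->] := modq_surj y; rewrite taut_facetsE !diffE => /chain_eq0 Jb.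
apply/chain_eq0 => g; have k1k : (k.-1 <= k)%N by exact: leq_pred.
have gD' := interior_face_subdivision hD hS k1k (valP g).
apply: (split_J k1k (valP g)).
suff <- : bd D' k (subdiv D D' k b) [` gD'] = bd D k b g by exact: Jb [` gD'].
rewrite free_map_comp !ffunE; apply: eq_bigr => u _; congr (_%:MP * _).
have uD' := interior_face_subdivision hD hS (leqnn k) (valP u).
have uk : #|` val u| == k.+1 = false.
  by have /interiorP[_ -> _] := valP u; rewrite ltn_eqF.
rewrite (big_fsetD1 (val u))//= /subdiv_coef uk eqxx mul1r.
rewrite big_seq big1 ?addr0// => t /fsetD1P[/negPf tu _].
by rewrite tu mul0r.
Qed.

Lemma Q_diffE (x : chain r D' k.+1) :
  Q_diff (Q_pi r D D' k.+1 x) = modq_pi (range (taut r D D' k)) (diff x).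
Proof.
pose F : {linear chain r D' k.+1 -> chain r D' k} :=
  HB.pack (@diff R k r D' k.+1) (GRing.isLinear.Build _ _ _ _ _ (@diff_linear D' k.+1)).
apply: (inducedE (f := F)) => _ [y _ <-]; apply: mem_gen.
by exists (diff y) => //; rewrite -taut_diff.
Qed.

Lemma taut_facets0 : taut r D D' k 0 = 0.
Proof.
pose T : {linear chain r D k -> chain r D' k} :=
  HB.pack (taut r D D' k) (GRing.isLinear.Build _ _ _ _ _ taut_facets_linear).
exact: (linear0 T).
Qed.

Lemma taut_splines x : splines r D x -> splines r D' (taut r D D' k.+1 x).
Proof.
move=> dx; apply: etrans (taut_diff x) _.
exact: etrans (congr1 (taut r D D' k) dx) taut_facets0.
Qed.

Lemma splines_taut x : splines r D' (taut r D D' k.+1 x) -> splines r D x.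
Proof.
by move=> dx; apply: taut_facets_inj; rewrite -taut_diff.
Qed.

Lemma Q_pi0 x : Q_pi r D D' k.+1 x = 0 <-> exists y, taut r D D' k.+1 y = x.
Proof. exact: (range_modq taut_cells_linear). Qed.

Lemma Q_pi_linear : linear (Q_pi r D D' k.+1).
Proof. exact: (@linearP _ _ _ _ (modq_pi (range (taut r D D' k.+1)))). Qed.

Lemma Q_top_homologyP (x : chain r D' k.+1) :
  Q_top_homology r D D' (Q_pi r D D' k.+1 x) <->
  exists y : chain r D k, taut r D D' k y = diff x.
Proof.
apply: iff_trans (range_modq taut_facets_linear (diff x)).
by split => e; [apply: etrans e; apply/esym|apply: etrans e]; exact: Q_diffE.
Qed.

Hypothesis acyclic : next_homology_vanishes r D.

(** Here the vanishing of the homology enters: the boundary of any lift of [z]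
    comes from a cycle of [D], thus from a boundary [diff w], and the image of
    [w] corrects the lift to a spline. *)
Lemma Q_top_homology_lift z : Q_top_homology r D D' z ->
  exists2 x, splines r D' x & Q_pi r D D' k.+1 x = z.
Proof.
have [x ->] : exists x, z = Q_pi r D D' k.+1 x := modq_surj z.
move=> /Q_top_homologyP[y yx].
have [w _ wy] := acyclic (lifted_boundary_cycle (esym yx)).
pose Q : {linear chain r D' k.+1 -> @Q R k r D D' k.+1} :=
  HB.pack (Q_pi r D D' k.+1) (GRing.isLinear.Build _ _ _ _ _ Q_pi_linear).
pose d' : {linear chain r D' k.+1 -> chain r D' k} :=
  HB.pack (@diff R k r D' k.+1) (GRing.isLinear.Build _ _ _ _ _ (@diff_linear D' k.+1)).
exists (x - taut r D D' k.+1 w).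
  apply: etrans (linearB d' x _) _; apply/eqP; rewrite subr_eq0; apply/eqP/esym.
  by apply: etrans (taut_diff w) _; apply: etrans yx; rewrite -wy.
apply: etrans (linearB Q x _) _; rewrite (_ : Q (taut _ _ _ _ w) = 0) ?subr0//.
by apply/Q_pi0; exists w.
Qed.

Lemma splines_short_exact :
  short_exact (splines r D) (splines r D') (Q_top_homology r D D')
    (taut r D D' k.+1) (Q_pi r D D' k.+1).
Proof.
pose T : {linear chain r D k.+1 -> chain r D' k.+1} :=
  HB.pack (taut r D D' k.+1) (GRing.isLinear.Build _ _ _ _ _ taut_cells_linear).
split.
- split; [exact: taut_cells_linear|exact: Q_pi_linear].
- by move=> _ [x dx <-]; exact: taut_splines.
- by move=> x _ tx; apply: taut_cells_inj; rewrite tx; apply/esym; exact: (linear0 T).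
- apply/seteqP; split => [_ [x dx <-]|x [dx /Q_pi0[y yx]]].
    by split; [exact: taut_splines dx|apply/Q_pi0; exists x].
  by exists y; [apply: splines_taut; rewrite yx|exact: yx].
- apply/seteqP; split => [_ [x dx <-]|z /Q_top_homology_lift[x dx <-]].
    by apply/Q_top_homologyP; exists 0; exact: etrans taut_facets0 (esym dx).
  by exists x; [exact: dx|].
Qed.

End Subdivided.
End Chains.

(** * The homogeneous parts and their dimensions *)

Section Graded.
Local Open Scope fset_scope.
Local Open Scope ring_scope.
Variables (R : realType) (k r : nat).
Local Notation point := 'rV[R]_k.
Local Notation face := {fset point}.
Local Notation complex := {fset {fset point}}.
Local Notation poly := {mpoly R[k.+1]}.
Implicit Types (K : complex).
Arguments J_chain {R k} r K j c.

(** The generators are powers of linear forms, so the ideal is homogeneous. *)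
Lemma J_pihomog K (s : face) d (p : poly) :
  p \in J r K s -> (pihomog mdeg d p : poly^o) \in J r K s.
Proof.
move=> /asboolP[q qJ ->]; rewrite linear_sum big_seq rpred_sum// => -[a g] /qJ.
move=> Eg /=; have [t [l [_ _ [lh _] gl]]] := Eg; rewrite /= in gl Eg.
have gh : (g : poly) \is r.+1.-homog.
  by rewrite gl -[X in X.-homog]mul1n; exact: dhomogMn.
rewrite -[_ *: _]/(a * (g : poly)) [a](pihomog_partitionE (leqnn (msize a))).
rewrite mulr_suml linear_sum rpred_sum// => e _.
have h := dhomogM (pihomogP mdeg e a) gh.
change (pihomog mdeg d (pihomog mdeg e a * g) \in J r K s).
have [<-|ne] := eqVneq (e + r.+1)%N d; last first.
  by rewrite (pihomog_ne0 ne h); exact: (@rpred0 poly^o).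
rewrite (pihomog_dE h); apply: (@rpredZ poly poly^o).
exact: mem_gen.
Qed.

Definition homog_part K j d (c : free_chain K j) : free_chain K j :=
  [ffun s => pihomog mdeg d (c s : poly)].

Lemma homog_part_homog K j d (c : free_chain K j) s :
  (homog_part d c s : poly) \is d.-homog.
Proof. by rewrite ffunE pihomogP. Qed.

Lemma homog_part_id K j d (c : free_chain K j) :
  (forall s, (c s : poly) \is d.-homog) -> homog_part d c = c.
Proof. by move=> hc; apply/ffunP => s; rewrite ffunE pihomog_dE. Qed.

Lemma homog_partB K j d (b c : free_chain K j) :
  homog_part d (b - c) = homog_part d b - homog_part d c.
Proof. by apply/ffunP => s; rewrite !ffunE linearB. Qed.

Lemma homog_part_free_map K K' i j d m (c : free_chain K i) :
  homog_part d (free_map K' j m c) = free_map K' j m (homog_part d c).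
Proof.
apply/ffunP => t; rewrite !ffunE linear_sum; apply: eq_bigr => s _ /=.
by rewrite ffunE !mul_mpolyC linearZ.
Qed.

Lemma chain_homog_pi K j d (c : free_chain K j) :
  chain_homog r K j d (modq_pi (J_chain r K j) (homog_part d c)).
Proof. by exists (homog_part d c) => // s; exact: homog_part_homog. Qed.

Lemma splines_homog_part K d (c : free_chain K k.+1) :
  splines r K (modq_pi (J_chain r K k.+1) c) ->
  splines r K (modq_pi (J_chain r K k.+1) (homog_part d c)).
Proof.
rewrite /splines /ker /= !diffE => /chain_eq0 Jc; apply/chain_eq0 => s.
by rewrite -homog_part_free_map ffunE; exact: J_pihomog.
Qed.

Definition monomial_chain K j d (sm : interior_faces K j * 'X_{1..k.+1 < d.+1}) :
    free_chain K j :=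
  [ffun t => if t == sm.1 then 'X_[sm.2] else 0].

Lemma chain_homog_span K j d x : chain_homog r K j d x ->
  exists a, x = lincomb (fun sm => modq_pi (J_chain r K j) (@monomial_chain K j d sm)) a.
Proof.
move=> [c hc ->].
exists (fun sm : interior_faces K j * 'X_{1..k.+1 < d.+1} => (c sm.1 : poly)@_(sm.2)).
rewrite -(lincomb_linear (f := modq_pi (J_chain r K j))); last exact: modq_pi_linear.
congr modq_pi; apply/ffunP => t; rewrite /lincomb sum_ffunE.
transitivity (\sum_(s : interior_faces K j) \sum_(m : 'X_{1..k.+1 < d.+1})
    ((c s : poly)@_m *: (if t == s then 'X_[m] else 0) : poly)); last first.
  by rewrite pair_bigA; apply: eq_bigr => sm _; rewrite !ffunE -mul_mpolyC.
rewrite (bigD1 t)//= [X in _ + X]big1 ?addr0 => [|s st]; last first.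
  by rewrite big1// => m _; rewrite eq_sym (negPf st) scaler0.
have cd : (msize (c t : poly) <= d.+1)%N.
  rewrite msizeE; apply/bigmax_leqP_seq => m mc _.
  by rewrite ltnS (dhomog_mf (hc t) mc).
by rewrite [LHS](mpolywE cd); apply: eq_bigr => m _; rewrite eqxx.
Qed.

Lemma homog_splines_subspace K d :
  real_subspace (splines r K `&` chain_homog r K k.+1 d)%classic.
Proof.
pose dd : {linear chain r K k.+1 -> chain r K k} :=
  HB.pack (@diff R k r K k.+1) (GRing.isLinear.Build _ _ _ _ _ (@diff_linear R k r K k.+1)).
apply: real_subspaceP.
- split; first exact: (linear0 dd).
  by exists 0; [move=> s; rewrite ffunE rpred0|rewrite linear0].
- move=> x y [dx [b hb xE]] [dy [c hc yE]]; split.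
    by apply: etrans (linearD dd x y) _; rewrite [dd x]dx [dd y]dy addr0.
  exists (b + c); last by rewrite linearD xE yE.
  by move=> s; rewrite ffunE rpredD// ?hb ?hc.
- move=> a x [dx [b hb xE]]; split.
    by apply: etrans (linearZ_LR dd _ x) _; rewrite [dd x]dx scaler0.
  exists (a%:MP *: b); last by rewrite linearZ_LR xE.
  by move=> s; rewrite ffunE /= -[_ *: _]/(a%:MP * _) mul_mpolyC rpredZ// hb.
Qed.

Section Subdivided.
Variables (D D' L : complex) (s0 : face).
Hypotheses (hD : simplicial_complex D) (hS : simple_subdivision D s0 L D').
Hypothesis hJ : forall g, g \in boundary L -> g \notin boundary D' ->
  J r D' g =i J r D g.
Hypothesis acyclic : next_homology_vanishes r D.

Local Notation subdiv := (@free_map R k D D' k.+1 k.+1 (@subdiv_coef R k)).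
Local Notation pi K := (modq_pi (J_chain r K k.+1)).

(** The preimage is unique, hence equal to its own part of degree [d]. *)
Lemma homog_spline_preimage d y :
  (splines r D' `&` chain_homog r D' k.+1 d)%classic y -> Q_pi r D D' k.+1 y = 0 ->
  exists2 x, (splines r D `&` chain_homog r D k.+1 d)%classic x &
    taut r D D' k.+1 x = y.
Proof.
move=> [dy [c hc yE]] /Q_pi0[x xy]; exists x => //; split.
  by apply: (splines_taut hD hS); rewrite xy.
have [b bE] := modq_surj x; rewrite bE in xy *.
have bc : subdiv b = c by apply: (@top_chain_inj R k r); rewrite -taut_cellsE xy.
have <- : homog_part d b = b; last exact: chain_homog_pi.
apply: (subdiv_cells_inj hD hS); rewrite -homog_part_free_map bc.
by rewrite homog_part_id.
Qed.

(** The part of degree [d] of any lift of [z] to a spline is again a lift,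
    because the lift differs from a homogeneous representative of [z] by the
    image of a chain. *)
Lemma homog_Q_lift d z :
  (Q_top_homology r D D' `&` Q_homog r D D' k.+1 d)%classic z ->
  exists2 y, (splines r D' `&` chain_homog r D' k.+1 d)%classic y &
    Q_pi r D D' k.+1 y = z.
Proof.
move=> [zT [_ [c hc ->] cz]].
have [x dx xz] := Q_top_homology_lift hD hS hJ acyclic zT.
have [c2 c2E] := modq_surj x; rewrite c2E in dx xz.
pose Q : {linear chain r D' k.+1 -> @Q R k r D D' k.+1} :=
  HB.pack (Q_pi r D D' k.+1) (GRing.isLinear.Build _ _ _ _ _ (@Q_pi_linear R k r D D')).
have QB u v : Q_pi r D D' k.+1 (u - v) = Q_pi r D D' k.+1 u - Q_pi r D D' k.+1 v.
  exact: (linearB Q).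
have : Q_pi r D D' k.+1 (pi D' c2 - pi D' c) = 0 by rewrite QB xz cz subrr.
move=> /Q_pi0[y yE]; have [b bE] := modq_surj y; rewrite bE in yE.
have sb : subdiv b = c2 - c.
  by apply: (@top_chain_inj R k r); rewrite -taut_cellsE yE linearB.
exists (pi D' (homog_part d c2)).
  by split; [exact: splines_homog_part dx|exact: chain_homog_pi].
apply/eqP; rewrite -subr_eq0 -cz -QB; apply/eqP/Q_pi0.
exists (pi D (homog_part d b)); rewrite taut_cellsE -homog_part_free_map sb.
by rewrite homog_partB (homog_part_id hc) linearB.
Qed.

Lemma taut_homog d x : chain_homog r D k.+1 d x ->
  chain_homog r D' k.+1 d (taut r D D' k.+1 x).
Proof.
move=> [c hc ->]; rewrite taut_cellsE -(homog_part_id hc) -homog_part_free_map.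
exact: chain_homog_pi.
Qed.

Lemma splines_dim d : exists a b : nat,
  [/\ has_dim (splines r D `&` chain_homog r D k.+1 d)%classic a,
      has_dim (Q_top_homology r D D' `&` Q_homog r D D' k.+1 d)%classic b
    & has_dim (splines r D' `&` chain_homog r D' k.+1 d)%classic (a + b)].
Proof.
have [_ TS Tinj kerQ Qsurj] := splines_short_exact hD hS hJ acyclic.
have [a dima] : exists a, has_dim (splines r D `&` chain_homog r D k.+1 d)%classic a.
  by apply: has_dim_exists => x [_ /chain_homog_span]; exact.
have [b dimb] : exists b,
    has_dim (Q_top_homology r D D' `&` Q_homog r D D' k.+1 d)%classic b.
  apply: (has_dim_exists (g := fun sm => Q_pi r D D' k.+1
    (pi D' (@monomial_chain D' k.+1 d sm)))).
  move=> _ [_ [x /chain_homog_span[c ->] <-]]; exists c.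
  exact: lincomb_linear (@Q_pi_linear R k r D D').
exists a, b; split => //.
apply: (has_dim_short_exact (@taut_cells_linear R k r D D') (@Q_pi_linear R k r D D')
  _ _ _ _ _ _ _ _ dima dimb).
- exact: homog_splines_subspace.
- exact: homog_splines_subspace.
- by move=> x [dx hx]; split; [exact: (taut_splines hD hS) dx|exact: taut_homog].
- move=> y [dy hy]; split; last by exists y.
  by rewrite -Qsurj; exists y.
- by move=> x [dx _]; exact: Tinj.
- by move=> x _; apply/Q_pi0; exists x.
- by move=> y; exact: homog_spline_preimage.
- by move=> z; exact: homog_Q_lift.
Qed.

End Subdivided.
End Graded.

Theorem corollary2p7 (R : realType) (k r : nat)
    (D D' : {fset {fset 'rV[R]_k}}) :
  simplicial_complex D ->
  split_subdivision r D D' ->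
  next_homology_vanishes r D ->
  short_exact (splines r D) (splines r D') (Q_top_homology r D D')
    (taut r D D' k.+1) (Q_pi r D D' k.+1) /\
  forall d : nat, exists a b : nat,
    [/\ has_dim (splines r D `&` chain_homog r D k.+1 d) a,
        has_dim (Q_top_homology r D D' `&` Q_homog r D D' k.+1 d) b
      & has_dim (splines r D' `&` chain_homog r D' k.+1 d) (a + b)].
Proof.
move=> hD [s [L [hS hJ]]] acyclic; split; first exact: splines_short_exact hS hJ acyclic.
by move=> d; exact: splines_dim hS hJ acyclic d.
Qed.
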